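(* Let $l$, $m$ and $d$ be positive integers and let $A_j\in\mathbb{R}^{l\times d}$ for $j=1,\dots,m$. Let $\varphi$ be a normal scale mixture and let $G:\mathbb{R}^{2d}\to\mathbb{R}^{l\times l}$ be a cross covariance function in $\mathbb{R}^d$. Let $M\in\mathbb{R}^{d\times d}$ be a positive definite matrix such that $M-\underline{A_j^\top G(x,y)A_k}$ is strictly positive definite for all $x,y\in\mathbb{R}^d$ and all $j,k=1,\dots,m$. Then $C=(C_{jk})_{j,k=1,\dots,m}$ is a cross covariance function in $\mathbb{R}^d$, where $$C_{jk}(x,y)=\frac{\varphi\left(\left[(x-y)^\top\big(M-\underline{A_j^\top G(x,y)A_k}\big)^{-1}(x-y)\right]^{1/2}\right)}{\sqrt{\big|M-\underline{A_j^\top G(x,y)A_k}\big|}},\qquad x,y\in\mathbb{R}^d,\ j,k=1,\dots,m.$$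
   Context: For a real square matrix $B$, $\underline{B}=(B+B^\top)/2$ denotes its symmetric part and $|B|$ its determinant. A Hermitian matrix $B\in\mathbb{C}^{n\times n}$ is called positive definite if $v^\top B\bar v\ge 0$ for all $v\in\mathbb{C}^n$, and strictly positive definite if $v^\top B\bar v>0$ for all $v\neq 0$. In particular (strictly) positive definite real matrices are symmetric. A normal scale mixture is a function $\varphi:[0,\infty)\to\mathbb{R}$ of the form $\varphi(h)=\int_{[0,\infty)}\exp(-ah^2)\,\mathrm{d}F(a)$, $h\ge0$, for some non-negative measure $F$ on $[0,\infty)$ (necessarily finite, since $\varphi(0)$ is a real number). The cross covariance function of a zero mean, second order, $m$-variate complex valued random field $Z(x)=(Z_1(x),\dots,Z_m(x))$, $x\in\mathbb{R}^d$ (i.e. $\mathrm{Var}\,Z_j(x)$ exists and $\mathbb{E}Z_j(x)=0$), is $C:\mathbb{R}^{2d}\to\mathbb{C}^{m\times m}$, $C_{jk}(x,y)=\mathrm{Cov}(Z_j(x),Z_k(y))=\mathbb{E}Z_j(x)\overline{Z_k(y)}$. A function $C:\mathbb{R}^{2d}\to\mathbb{C}^{m\times m}$ is a cross covariance function in $\mathbb{R}^d$ if it is the cross covariance function of such a field; equivalently $C(x,y)=\overline{C^\top(y,x)}$ for all $x,y$ and $\sum_{p,q=1}^n a_p^\top C(x_p,x_q)\bar a_q\ge0$ for all $n\in\mathbb{N}$, $x_1,\dots,x_n\in\mathbb{R}^d$, $a_1,\dots,a_n\in\mathbb{C}^m$. *)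

(* Defs.v *)
From HB Require Import structures.
From mathcomp Require Import all_boot all_order all_algebra.
From mathcomp Require Import all_classical all_reals all_analysis.
From mathcomp Require Export complex.
Set Implicit Arguments.
Unset Strict Implicit.
Unset Printing Implicit Defensive.
Import Order.TTheory GRing.Theory Num.Theory.
Local Open Scope classical_set_scope.
Local Open Scope ring_scope.
Local Open Scope complex_scope.

Definition complexmx (R : realType) (p q : nat) (B : 'M[R]_(p, q)) :
    'M[R[i]]_(p, q) :=
  map_mx (fun t : R => t%:C) B.

Definition sympart (R : realType) (n : nat) (B : 'M[R]_n) : 'M[R]_n :=
  2^-1 *: (B + B^T).

(* [0 <= z] in R[i] means that z is real and nonnegative.  "Positive definite"
   allows a nontrivial kernel; the strict version does not. *)
Definition posdefmx (R : realType) (n : nat) (B : 'M[R[i]]_n) : Prop :=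
  B \is hermsymmx /\
  forall v : 'cV[R[i]]_n, 0 <= (v^T *m B *m map_mx Num.conj v) 0 0.

Definition strict_posdefmx (R : realType) (n : nat) (B : 'M[R[i]]_n) : Prop :=
  B \is hermsymmx /\
  forall v : 'cV[R[i]]_n, v != 0 -> 0 < (v^T *m B *m map_mx Num.conj v) 0 0.

(* Only the values of [phi] on [0, +oo[ and the trace of [F] on [0, +oo[ matter;
   taking h = 0 shows that [F] has finite mass there. *)
Definition normal_scale_mixture (R : realType) (phi : R -> R) : Prop :=
  exists F : {measure set (measurableTypeR R) -> \bar R},
    forall h : R, 0 <= h ->
      (\int[F]_(a in `[0%R, +oo[) (expR (- a * h ^+ 2))%:E = (phi h)%:E)%E.

(* Membership in [Lfun] includes measurability. *)
Definition square_integrable (dT : measure_display) (T : measurableType dT)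
    (R : realType) (P : probability T R) (X : T -> R[i]) : Prop :=
  (fun w => complex.Re (X w)) \in Lfun P 2%:E /\
  (fun w => complex.Im (X w)) \in Lfun P 2%:E.

(* [fine] loses nothing here: this is only applied to integrable variables
   (square integrable ones and products of two of them). *)
Definition cexpectation (dT : measure_display) (T : measurableType dT)
    (R : realType) (P : probability T R) (X : T -> R[i]) : R[i] :=
  fine 'E_P[fun w => complex.Re (X w)]%E
    +i* fine 'E_P[fun w => complex.Im (X w)]%E.

Definition is_cross_covariance_of (dT : measure_display)
    (T : measurableType dT) (R : realType) (P : probability T R) (d m : nat)
    (Z : 'cV[R]_d -> 'I_m -> T -> R[i])
    (C : 'cV[R]_d -> 'cV[R]_d -> 'M[R[i]]_m) : Prop :=
  [/\ forall x j, square_integrable P (Z x j),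
      forall x j, cexpectation P (Z x j) = 0 &
      forall x y j k,
        C x y j k = cexpectation P (fun w => Z x j w * Num.conj (Z y k w))].

Definition cross_covariance (R : realType) (d m : nat)
    (C : 'cV[R]_d -> 'cV[R]_d -> 'M[R[i]]_m) : Prop :=
  exists (dT : measure_display) (T : measurableType dT) (P : probability T R)
    (Z : 'cV[R]_d -> 'I_m -> T -> R[i]), is_cross_covariance_of P Z C.

(* Main.v *)
(** For a fixed frequency [eta] the kernel
    [cos (eta . (x - y)) * exp ((A_j eta)^T G(x,y) (A_k eta) / 2)] is the second
    moment of an explicit random field: powers of [G]-forms come from products
    of independent copies of the field with covariance [G], the exponential from
    a random number of copies, and the cosine from a fair choice between [cos]
    and [sin].  Multiplying by [exp (- eta^T M eta / 2)], drawing [eta] at random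
    and scaling the frequency by [sqrt (2 a)], with [a] drawn from the mixing
    measure, turns the exponent into [- eta^T S eta / 2] with
    [S = M - sympart (A_j^T G(x,y) A_k)]; the Gaussian Fourier integral
    [E exp (i h.eta)] then gives [exp (- a (x-y)^T S^-1 (x-y)) / sqrt |S|].  Hence
    the field itself can be written down on a product probability space, a random
    sign making it centred, and no extension theorem is needed. *)
From HB Require Import structures.
Require Import Defs.
From mathcomp Require Import all_boot all_order all_algebra.
From mathcomp Require Import all_classical all_reals all_analysis.
From mathcomp Require Import measurable_realfun lebesgue_integral_under.
From mathcomp Require Import ring lra.
Set Implicit Arguments.
Unset Strict Implicit.
Unset Printing Implicit Defensive.
Import Order.TTheory GRing.Theory Num.Theory.
Import numFieldNormedType.Exports.
Local Open Scope classical_set_scope.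
Local Open Scope ring_scope.

(** * The one-dimensional Gaussian Fourier integral *)

(** The matrix S depends on the two points separately and on j, k, so the target kernel is not
    stationary and no spectral theorem for stationary kernels applies. Fixing eta first removes the
    inverse and the determinant: what remains in the exponent is (A_j eta)^T G(x,y) (A_k eta), a
    positive semidefinite kernel in the indices (x, j) and (y, k) because G is a cross covariance,
    and such kernels are stable under products and exponentials. The factor exp (- eta^T M eta / 2)
    is the same for all indices, so its square root can be put into the field. One random eta must
    serve all the matrices S at once. It is therefore drawn from the fixed standard normal law, and
    the integrands carry exp (|eta|^2 / 2), which cancels that density up to a constant. Strict
    positivity of S at x = y, j = k makes the second moments of the averaged field finite; at the
    other indices it gives the value of the Gaussian integral. Since G is real, cosines can replace
    complex exponentials throughout, and the constructed field is real. *)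

Section gauss_weight.
Context {R : realType}.
Local Notation mu := (@lebesgue_measure R).

(** With [s] the pivot of S and [b] the product of the pivot column with the remaining coordinates,
    this is the part of exp (- v^T S v / 2) that involves the first coordinate [u] of v. *)
Definition gauss_weight (s b u : R) : R := expR (- (s * u ^+ 2 / 2 + b * u)).

Lemma gauss_weight_ge0 (s b u : R) : 0 <= gauss_weight s b u.
Proof. exact: expR_ge0. Qed.

Lemma is_derive_gauss_weight (s b u : R) :
  is_derive u 1 (gauss_weight s b) (- (s * u + b) * gauss_weight s b u).
Proof.
rewrite /gauss_weight; apply: is_derive_eq.
by rewrite /GRing.scale /= mulr0; field.
Qed.

Lemma continuous_gauss_weight (s b : R) : continuous (gauss_weight s b).
Proof.
move=> u; apply/differentiable_continuous/derivable1_diffP.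
by have [] := is_derive_gauss_weight s b u.
Qed.

Lemma measurable_gauss_weight (s b : R) : measurable_fun setT (gauss_weight s b).
Proof. by apply: continuous_measurable_fun; exact: continuous_gauss_weight. Qed.

Lemma integral_gauss_weight (s b : R) : 0 < s ->
  (\int[mu]_u (gauss_weight s b u)%:E =
   (Num.sqrt (2 * pi / s) * expR (b ^+ 2 / (2 * s)))%:E)%E.
Proof.
move=> s0; have sN0 : s != 0 by rewrite gt_eqF.
pose sg := (Num.sqrt s)^-1.
have sg2 : sg ^+ 2 = s^-1 by rewrite exprVn sqr_sqrtr// ltW.
have sgN0 : sg != 0 by rewrite invr_eq0 gt_eqF// sqrtr_gt0.
set c := _ * _.
(* Completing the square: a multiple of the normal density with mean - b / s and variance 1 / s. *)
rewrite (_ : (fun u => _) = (fun u => c%:E * (normal_pdf (- b / s) sg u)%:E)%E).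
  rewrite ge0_integralZl//.
  - by rewrite integral_normal_pdf mule1.
  - by apply/measurable_EFinP; exact: measurable_normal_pdf.
  - by move=> u _; rewrite lee_fin normal_pdf_ge0.
  - by rewrite lee_fin mulr_ge0 ?expR_ge0.
apply/funext => u; rewrite -EFinM; congr EFin.
rewrite normal_pdfE// /normal_peak /normal_fun sg2 /c.
rewrite (_ : s^-1 * pi *+ 2 = 2 * pi / s); last by rewrite -mulr_natl; field.
rewrite mulrACA mulfV; last first.
  by rewrite gt_eqF// sqrtr_gt0 !mulr_gt0 ?pi_gt0 ?invr_gt0.
rewrite mul1r -expRD /gauss_weight; congr expR.
by rewrite -mulr_natl; field.
Qed.

Lemma integrable_gauss_weight (s b : R) : 0 < s ->
  mu.-integrable setT (fun u => (gauss_weight s b u)%:E).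
Proof.
move=> s0; apply/integrableP; split.
  by apply/measurable_EFinP; exact: measurable_gauss_weight.
under eq_integral do rewrite gee0_abs ?lee_fin ?gauss_weight_ge0//.
by rewrite integral_gauss_weight// ltry.
Qed.

(** Expand (s |u| - (|b| + 1))^2 >= 0. This decay is what kills the boundary terms at infinity. *)
Lemma gauss_weight_decay (s b u : R) : 0 < s ->
  gauss_weight s b u <= expR ((`|b| + 1) ^+ 2 / (2 * s)) * expR (- `|u|).
Proof.
move=> s0; rewrite -expRD ler_expR.
have bu : - (`|b| * `|u|) <= b * u.
  by rewrite -normrM lerNl -normrN ler_norm.
rewrite -[u ^+ 2]real_normK ?num_real//.
set x := `|u| in bu *; set y := `|b| in bu *.
suff : 0 <= (s * x - (y + 1)) ^+ 2 / (2 * s).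
  have -> : (s * x - (y + 1)) ^+ 2 / (2 * s) =
    s * x ^+ 2 / 2 - (y + 1) * x + (y + 1) ^+ 2 / (2 * s).
    by field; rewrite gt_eqF.
  by move: bu; lra.
by rewrite divr_ge0 ?sqr_ge0// mulr_ge0// ltW.
Qed.

(** Replacing [b] by b - 1 or b + 1 multiplies the weight by exp u or exp (- u), and |u| <= exp u +
    exp (- u). A factor |u| is thus absorbed into weights of the same family. *)
Lemma norm_mul_gauss_weight (s b u : R) : `|u| * gauss_weight s b u <=
  gauss_weight s (b - 1) u + gauss_weight s (b + 1) u.
Proof.
have E c : gauss_weight s (b + c) u = expR (- (c * u)) * gauss_weight s b u.
  by rewrite /gauss_weight -expRD; congr expR; ring.
rewrite !E -mulrDl ler_wpM2r ?gauss_weight_ge0// ler_norml.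
have := expR_ge1Dx (- (-1 * u)); have := expR_ge1Dx (- (1 * u)).
have := expR_ge0 (- (-1 * u)); have := expR_ge0 (- (1 * u)).
by move=> *; apply/andP; split; lra.
Qed.

End gauss_weight.

(** * Evaluating the Fourier integral by differentiation in the frequency *)

Section gauss_fourier.
Context {R : realType}.
Local Notation mu := (@lebesgue_measure R).

(** The function |g| dominates the truncations of [g] to symmetric intervals, so the integral is the
    limit of F n - F (- n). *)
Lemma integral_derivative_eq0 (F g : R -> R) :
  mu.-integrable setT (fun u => (g u)%:E) -> continuous g ->
  (forall u : R, is_derive u (1 : R) F (g u)) ->
  F n%:R @[n --> \oo] --> 0 -> F (- n%:R) @[n --> \oo] --> 0 ->
  (\int[mu]_u (g u)%:E = 0)%E.
Proof.
move=> gi cg Fg F0 FN0.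
pose A n : set R := `[(- n%:R), n%:R]%classic.
have mg : measurable_fun setT (fun u => (g u)%:E) by exact: measurable_int gi.
(* The shift to [n.+1] keeps the interval nondegenerate, as the fundamental theorem of calculus
   requires. *)
have FTC n : (\int[mu]_(u in A n.+1) (g u)%:E = (F n.+1%:R - F (- n.+1%:R))%:E)%E.
  rewrite /A (@continuous_FTC2 _ g F) ?EFinB//.
  - by rewrite -subr_gt0 opprK addr_gt0// ltr0n.
  - exact: continuous_subspaceT.
  - have cF : continuous F.
      move=> u; apply/differentiable_continuous/derivable1_diffP.
      by have [] := Fg u.
    split => [u _| |]; first by have [] := Fg u.
      exact/cvg_at_right_filter/cF.
    exact/cvg_at_left_filter/cF.
  - by move=> u _; rewrite derive1E; have [_] := Fg u.
have H : (fun n => \int[mu]_u (((fun u => (g u)%:E) \_ (A n.+1)) u))%E @ \oo -->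
    (\int[mu]_u (g u)%:E)%E.
  have mA n : measurable (A n) by exact: measurable_itv.
  apply: (@dominated_cvg _ _ _ mu setT measurableT
    (fun n => (fun u => (g u)%:E) \_ (A n.+1)) _ (fun u => `|(g u)%:E|%E)) => //.
  - by move=> n; apply/(measurable_restrictT _ (mA _)); exact: measurable_funTS mg.
  - move=> u _; apply: cvg_near_cst; near=> n.
    rewrite patchE ifT// inE /A /= in_itv /= -ler_norml.
    near: n; exists (Num.bound `|u|) => // n /= un.
    apply: (le_trans (ltW (archi_boundP (normr_ge0 u)))); rewrite ler_nat.
    exact: leq_trans un _.
  - exact: integrable_abse.
  - move=> n u _; rewrite patchE; case: ifPn => // _.
    by rewrite abse0.
have H' : (fun n => (F n.+1%:R - F (- n.+1%:R))%:E) @ \oo --> 0%E.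
  apply: cvg_EFin; first exact: nearW.
  rewrite -[0%R]subr0; apply: cvgB.
    by move: F0; rewrite -cvg_shiftS.
  by move: FN0; rewrite -cvg_shiftS.
have E : (fun n => \int[mu]_u (((fun u => (g u)%:E) \_ (A n.+1)) u))%E =
   (fun n => (F n.+1%:R - F (- n.+1%:R))%:E).
  by apply/funext => n; rewrite -integral_mkcond FTC.
by rewrite E in H; exact: (cvg_unique _ H H').
Unshelve. all: end_near. Qed.

Variables (s b c : R).
Hypothesis s0 : 0 < s.
Let sN0 : s != 0. Proof. by rewrite gt_eqF. Qed.
Local Notation w := (gauss_weight s b).

(* [df] is at once the [h]-derivative of [f] and the [u]-derivative of [F], so
   the integral of [f h] does not depend on [h]. *)
Let e (h : R) := expR (h ^+ 2 / (2 * s)).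
Let th (h u : R) := h * (u + b / s) + c.
Let f (h u : R) := e h * cos (th h u) * w u.
Let df (h u : R) := e h * (h / s * cos (th h u) - (u + b / s) * sin (th h u)) * w u.
Let F (h u : R) := s^-1 * e h * sin (th h u) * w u.

Let is_derive_f (h u : R) : is_derive h 1 (f ^~ u) (df h u).
Proof.
rewrite /f /e /th; apply: is_derive_eq.
by rewrite /df /e /th /GRing.scale /=; field.
Qed.

Let is_derive_F (h u : R) : is_derive u 1 (F h) (df h u).
Proof.
have ? := @is_derive_gauss_weight R s b.
rewrite /F /th; apply: is_derive_eq.
by rewrite /df /e /th /GRing.scale /=; field.
Qed.

Let mcos : measurable_fun setT (@cos R).
Proof. by apply: continuous_measurable_fun; exact: continuous_cos. Qed.

Let cos_le1 x : `|cos x| <= 1 :> R.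
Proof. by rewrite ler_norml cos_geN1 cos_le1. Qed.

Let sin_le1 x : `|sin x| <= 1 :> R.
Proof. by rewrite ler_norml sin_geN1 sin_le1. Qed.

Let mth h : measurable_fun setT (th h).
Proof.
apply: measurable_funD => //; apply: measurable_funM => //.
exact: measurable_funD.
Qed.

Let mw : measurable_fun setT w. Proof. exact: measurable_gauss_weight. Qed.

Let integrable_f h : mu.-integrable setT (EFin \o f h).
Proof.
apply: (@le_integrable _ _ _ mu setT measurableT _ (fun u => ((e h)%:E * (w u)%:E)%E)).
- apply/measurable_EFinP; apply: measurable_funM => //.
  by apply: measurable_funM => //; exact: (measurableT_comp mcos (mth h)).
- move=> u _ /=; rewrite lee_fin /f !normrM.
  rewrite ler_wpM2r// -[leRHS]mulr1 ler_wpM2l//.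
- by apply: integrableZl => //; exact: integrable_gauss_weight.
Qed.

(** Majorant of |df h u| uniform over |h| <= B; the two tilted weights pay for the factor |u| that
    appears when the cosine is differentiated in [h]. *)
Let dom (B u : R) := expR (B ^+ 2 / (2 * s)) * (B / s + `|b| / s + 1) *
  (w u + (gauss_weight s (b - 1) u + gauss_weight s (b + 1) u)).

Let dom_ge0 (B u : R) : 0 <= B -> 0 <= dom B u.
Proof.
move=> B0; rewrite mulr_ge0//.
  by rewrite mulr_ge0 ?expR_ge0// !addr_ge0// divr_ge0// ltW.
by rewrite !addr_ge0 ?gauss_weight_ge0.
Qed.

Let integrable_dom B : mu.-integrable setT (EFin \o dom B).
Proof.
rewrite /dom /comp; under eq_fun do rewrite EFinM !EFinD.
apply: integrableZl => //; apply: integrableD => //.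
  exact: integrable_gauss_weight.
by apply: integrableD => //; exact: integrable_gauss_weight.
Qed.

Let df_le_dom (B h u : R) : `|h| <= B -> `|df h u| <= dom B u.
Proof.
move=> hB; rewrite /df /dom /e !normrM -[leLHS]mulrA -[leRHS]mulrA.
have B0 : 0 <= B by exact: le_trans hB.
apply: ler_pM => //.
  rewrite ger0_norm ?expR_ge0// ler_expR ler_pM2r ?invr_gt0 ?mulr_gt0//.
  by rewrite -[h ^+ 2]real_normK ?num_real// lerXn2r ?nnegrE.
rewrite (ger0_norm (gauss_weight_ge0 _ _ _)).
have w0 := gauss_weight_ge0 s b u.
have uw := norm_mul_gauss_weight s b u.
have w10 : 0 <= gauss_weight s (b - 1) u + gauss_weight s (b + 1) u.
  by rewrite addr_ge0 ?gauss_weight_ge0.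
set w1 := gauss_weight s (b - 1) u + _ in uw w10 *; clearbody w1.
have bs0 : 0 <= `|b| / s by rewrite divr_ge0// ltW.
have Bs0 : 0 <= B / s by rewrite divr_ge0// ltW.
apply: (@le_trans _ _ ((B / s + (`|u| + `|b| / s)) * w u)); last first.
  rewrite !mulrDl !mulrDr !mul1r.
  have := mulr_ge0 bs0 w10; have := mulr_ge0 Bs0 w10; lra.
rewrite ler_wpM2r// (le_trans (ler_normB _ _))// lerD//.
  rewrite normrM -[leRHS]mulr1 ler_pM// normrM normfV (gtr0_norm s0).
  by rewrite ler_pM2r ?invr_gt0.
rewrite normrM -[leRHS]mulr1 ler_pM// (le_trans (ler_normD _ _))// lerD//.
by rewrite normrM normfV (gtr0_norm s0).
Qed.

Let derive1_f h u : derive1 (f ^~ u) h = df h u.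
Proof. by rewrite derive1E; have [_] := is_derive_f h u. Qed.

Let continuous_df h : continuous (df h).
Proof.
move=> u; have ? := @is_derive_gauss_weight R s b.
apply/differentiable_continuous/derivable1_diffP.
rewrite /df /th; apply: ex_derive.
Qed.

Let integrable_df h : mu.-integrable setT (EFin \o df h).
Proof.
apply: (@le_integrable _ _ _ mu setT measurableT _ (EFin \o dom `|h|)).
- apply/measurable_EFinP; apply: continuous_measurable_fun.
  exact: continuous_df.
- by move=> u _ /=; rewrite lee_fin (ger0_norm (dom_ge0 _ _))// df_le_dom.
- exact: integrable_dom.
Qed.

Let F_le (h u : R) : `|F h u| <=
  s^-1 * e h * expR ((`|b| + 1) ^+ 2 / (2 * s)) * expR (- `|u|).
Proof.
rewrite /F !normrM normfV (gtr0_norm s0) !(ger0_norm (expR_ge0 _)).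
rewrite -[leLHS]mulrA -[leRHS]mulrA ler_wpM2l ?mulr_ge0 ?invr_ge0 ?expR_ge0 ?(ltW s0)//.
rewrite -[leRHS]mul1r ler_pM//; exact: gauss_weight_decay.
Qed.

Let cvg_F h : F h n%:R @[n --> \oo] --> 0 /\ F h (- n%:R) @[n --> \oo] --> 0.
Proof.
set K : R := s^-1 * e h * expR ((`|b| + 1) ^+ 2 / (2 * s)).
have K0 : (fun n : nat => K * expR (- n%:R)) @ \oo --> 0.
  by rewrite -[0](mulr0 K); apply: cvgM; [exact: cvg_cst|exact: cvgn_expR].
have K0N : (fun n : nat => - (K * expR (- n%:R))) @ \oo --> 0.
  by rewrite -[0]oppr0; exact: cvgN.
split; apply: (squeeze_cvgr _ K0N K0); apply: nearW => n;
  by rewrite -ler_norml; apply: (le_trans (F_le _ _)); rewrite ?normrN normr_nat.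
Qed.

Let integral_df0 h : (\int[mu]_u (df h u)%:E = 0)%E.
Proof.
have [F0 FN0] := cvg_F h.
by apply: integral_derivative_eq0 (integrable_df h) _ (is_derive_F h) F0 FN0.
Qed.

Let integral_f h : (\int[mu]_u (f h u)%:E = \int[mu]_u (f 0 u)%:E)%E.
Proof.
rewrite -(fineK (integrable_fin_num measurableT (integrable_f h))).
rewrite -(fineK (integrable_fin_num measurableT (integrable_f 0))).
congr EFin; pose J x := (\int[mu]_u f x u)%R.
suff : J h = J 0 by [].
apply: is_derive_0_is_cst => x.
(* The majorant is uniform only over bounded frequencies, so the derivative at [x] is taken inside a
   bounded open interval around it. *)
have xB : `](- (`|x| + 1)), (`|x| + 1)[%classic x.
  rewrite /= in_itv /=; apply/andP; split.
    have := ler_norm (- x); rewrite normrN; lra.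
  have := ler_norm x; lra.
have ltB y : `](- (`|x| + 1)), (`|x| + 1)[%classic y -> `|y| <= `|x| + 1.
  by rewrite /= in_itv /= -ltr_norml => /ltW.
have int y : `](- (`|x| + 1)), (`|x| + 1)[%classic y ->
  mu.-integrable setT (EFin \o f y) by [].
have der y u : `](- (`|x| + 1)), (`|x| + 1)[%classic y -> [set: R] u ->
  derivable (f ^~ u) y 1 by move=> _ _; have [] := is_derive_f y u.
have B0 : 0 <= `|x| + 1 by rewrite addr_ge0.
have domB y u : `](- (`|x| + 1)), (`|x| + 1)[%classic y -> [set: R] u ->
  `|partial1of2 f y u| <= dom (`|x| + 1) u.
  by move=> /ltB yB _; rewrite /partial1of2 derive1_f; exact: df_le_dom.
have dJ := derivable_under_integral measurableT xB int der
  (fun u => dom_ge0 u B0) (integrable_dom _) domB.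
have J'0 := differentiation_under_integral measurableT xB int der
  (fun u => dom_ge0 u B0) (integrable_dom _) domB.
apply: DeriveDef; first exact: dJ.
rewrite -derive1E [LHS]J'0 /Rintegral /partial1of2.
by under eq_integral do rewrite derive1_f; rewrite integral_df0.
Qed.

Let integral_f0 : (\int[mu]_u (f 0 u)%:E =
  (cos c * (Num.sqrt (2 * pi / s) * expR (b ^+ 2 / (2 * s))))%:E)%E.
Proof.
transitivity (\int[mu]_u ((cos c)%:E * (w u)%:E))%E.
  apply: eq_integral => u _; rewrite -EFinM; congr EFin.
  by rewrite /f /e /th expr0n /= !mul0r expR0 mul1r add0r.
by rewrite integralZl//; [rewrite integral_gauss_weight|exact: integrable_gauss_weight].
Qed.

(** At h = 0 the integral of [f] is a plain Gaussian integral; dividing this constant by [e h]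
    produces the damping factor. *)
Lemma integral_cos_gauss_weight_centered h :
  (\int[mu]_u (cos (h * (u + b / s) + c) * w u)%:E =
  (cos c * expR (- (h ^+ 2 / (2 * s))) *
   (Num.sqrt (2 * pi / s) * expR (b ^+ 2 / (2 * s))))%:E)%E.
Proof.
transitivity ((expR (- (h ^+ 2 / (2 * s))))%:E * \int[mu]_u (f h u)%:E)%E.
  rewrite -integralZl//; last exact: integrable_f.
  apply: eq_integral => u _; rewrite -EFinM; congr EFin.
  by rewrite /f /e -mulrA [RHS]mulrA -expRD addNr expR0 mul1r.
by rewrite integral_f integral_f0 -EFinM; congr EFin; ring.
Qed.

End gauss_fourier.

Section normal_integral.
Context {R : realType}.
Local Notation mu := (@lebesgue_measure R).

(** The Radon-Nikodym derivative and [normal_pdf] have equal integrals over every measurable set,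
    hence agree almost everywhere. *)
Lemma ge0_integral_normal_prob (m sigma : R) (f : measurableTypeR R -> \bar R) :
  measurable_fun setT f -> (forall x, 0 <= f x)%E ->
  (\int[normal_prob m sigma]_x f x = \int[mu]_x (f x * (normal_pdf m sigma x)%:E))%E.
Proof.
move=> mf f0.
have dom := normal_prob_dominates m sigma.
rewrite -(Radon_Nikodym_SigmaFinite.change_of_variables dom)//.
have mpdf : measurable_fun setT (fun x => (normal_pdf m sigma x)%:E).
  by apply/measurable_EFinP; exact: measurable_normal_pdf.
have iRN := Radon_Nikodym_SigmaFinite.f_integrable dom.
apply: ae_eq_integral => //.
- by apply: emeasurable_funM => //; exact: (measurable_int _ iRN).
- by apply: emeasurable_funM => //; exact: mpdf.
- apply: ae_eqe_mul2l; apply: (integral_ae_eq _ iRN mpdf) => //.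
  by move=> A _ mA; rewrite -Radon_Nikodym_SigmaFinite.f_integral.
Qed.

Lemma integral_cos_gauss_weight (s b c h : R) : 0 < s ->
  (\int[mu]_u (cos (h * u + c) * gauss_weight s b u)%:E =
  (Num.sqrt (2 * pi / s) * expR (b ^+ 2 / (2 * s)) *
   (expR (- (h ^+ 2 / (2 * s))) * cos (c - h * b / s)))%:E)%E.
Proof.
move=> s0.
transitivity (\int[mu]_u
    (cos (h * (u + b / s) + (c - h * b / s)) * gauss_weight s b u)%:E)%E.
  by apply: eq_integral => u _; congr (cos _ * _)%:E; ring.
by rewrite integral_cos_gauss_weight_centered//; congr EFin; ring.
Qed.

Lemma integrable_cos_gauss_weight (s b c h : R) : 0 < s ->
  mu.-integrable setT (fun u => (cos (h * u + c) * gauss_weight s b u)%:E).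
Proof.
move=> s0.
apply: (@le_integrable _ _ _ mu setT measurableT _ (fun u => (gauss_weight s b u)%:E)).
- apply/measurable_EFinP; apply: measurable_funM; last exact: measurable_gauss_weight.
  apply: (@measurableT_comp _ _ _ _ _ _ (@cos R)).
    by apply: continuous_measurable_fun; exact: continuous_cos.
  by apply: measurable_funD => //; exact: measurable_funM.
- move=> u _ /=; rewrite lee_fin normrM -[leRHS]mul1r ler_pM//.
    by rewrite ler_norml cos_geN1 cos_le1.
- exact: integrable_gauss_weight.
Qed.

Lemma integral_normal_cos (s b c h r : R) : 0 < s -> `|r| <= 1 ->
  (\int[normal_prob 0 1]_(u in [set: measurableTypeR R])
     ((1 + r * cos (h * u + c)) * expR (u ^+ 2 / 2) * gauss_weight s b u)%:E =
  ((Num.sqrt s)^-1 * expR (b ^+ 2 / (2 * s)) *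
   (1 + r * expR (- (h ^+ 2 / (2 * s))) * cos (c - h * b / s)))%:E)%E.
Proof.
move=> s0 r1.
have rcos x : 0 <= 1 + r * cos x.
  have : `|r * cos x| <= 1.
    by rewrite normrM -[leRHS]mulr1 ler_pM// ler_norml cos_geN1 cos_le1.
  by rewrite ler_norml => /andP[+ _]; lra.
rewrite ge0_integral_normal_prob; last 2 first.
- apply/measurable_EFinP; apply: measurable_funM; last exact: measurable_gauss_weight.
  apply: measurable_funM.
    apply: measurable_funD => //; apply: measurable_funM => //.
    apply: (@measurableT_comp _ _ _ _ _ _ (@cos R)).
      by apply: continuous_measurable_fun; exact: continuous_cos.
    by apply: measurable_funD => //; exact: measurable_funM.
  apply: measurableT_comp => //.
  by apply: measurable_funM => //; exact: measurable_funX.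
- by move=> u; rewrite lee_fin !mulr_ge0 ?expR_ge0.
(* What is left of the standard normal density once exp (u^2 / 2) has cancelled its exponential. *)
pose k : R := (Num.sqrt (2 * pi))^-1.
transitivity (\int[mu]_u (k%:E * ((gauss_weight s b u)%:E +
   r%:E * (cos (h * u + c) * gauss_weight s b u)%:E)))%E.
  apply: eq_integral => u _.
  rewrite -!EFinM; congr EFin.
  rewrite normal_pdfE ?oner_eq0// /normal_peak /normal_fun expr1n mul1r subr0.
  rewrite -(mulr_natl pi) -/k.
  rewrite (_ : - u ^+ 2 / (1 *+ 2) = - (u ^+ 2 / 2)); last by rewrite mulNr.
  have := expRxMexpNx_1 (u ^+ 2 / 2).
  move: (expR (u ^+ 2 / 2)) (expR (- (u ^+ 2 / 2))) => x y xy.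
  transitivity ((1 + r * cos (h * u + c)) * gauss_weight s b u * k * (x * y)).
    by ring.
  by rewrite xy; ring.
have iw := integrable_gauss_weight b s0.
have ic := integrable_cos_gauss_weight b c h s0.
rewrite integralZl//; last by apply: integrableD => //; exact: integrableZl.
rewrite integralD//; last exact: integrableZl.
rewrite integralZl// integral_gauss_weight// integral_cos_gauss_weight//.
rewrite -!EFinM; congr EFin.
have -> : Num.sqrt (2 * pi / s) = k^-1 * (Num.sqrt s)^-1.
  by rewrite sqrtrM ?mulr_ge0 ?pi_ge0// sqrtrV ?ltW// /k invrK.
have k0 : k != 0 by rewrite invr_eq0 gt_eqF// sqrtr_gt0 mulr_gt0 ?pi_gt0.
by field; rewrite k0 gt_eqF// sqrtr_gt0.
Qed.

End normal_integral.

(** * Schur complements of positive definite matrices *)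

Definition quadmx (R : pzRingType) (n : nat) (S : 'M[R]_n) (v : 'cV[R]_n) : R :=
  (v^T *m S *m v) 0 0.

Definition real_posdef (R : realFieldType) (n : nat) (S : 'M[R]_n) : Prop :=
  S^T = S /\ forall v : 'cV[R]_n, v != 0 -> 0 < quadmx S v.

Section schur.
Variables (R : realFieldType) (n : nat) (S : 'M[R]_(1 + n)).
Hypothesis Spd : real_posdef S.

Definition pivot : R := ulsubmx S 0 0.
Definition pivot_col : 'cV[R]_n := dlsubmx S.
Definition schurmx : 'M[R]_n := drsubmx S - pivot^-1 *: (pivot_col *m pivot_col^T).

Let SE : S = block_mx pivot%:M pivot_col^T pivot_col (drsubmx S).
Proof.
rewrite -[LHS]submxK; congr block_mx; first exact: mx11_scalar.
by rewrite /pivot_col trmx_dlsub; have [-> _] := Spd.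
Qed.

Let colE (z : 'cV[R]_n) : pivot_col^T *m z = ((pivot_col^T *m z) 0 0)%:M.
Proof. exact: mx11_scalar. Qed.

Let rowE (z : 'cV[R]_n) : z^T *m pivot_col = ((pivot_col^T *m z) 0 0)%:M.
Proof. by rewrite -tr_scalar_mx -colE trmx_mul trmxK. Qed.

Lemma quadmx_col (u : R) (z : 'cV[R]_n) :
  quadmx S (col_mx u%:M z) =
  pivot * u ^+ 2 + 2 * ((pivot_col^T *m z) 0 0 * u) + quadmx (drsubmx S) z.
Proof.
rewrite /quadmx {1}SE tr_col_mx mul_row_block mul_row_col tr_scalar_mx.
rewrite !mulmxDl rowE -(mulmxA u%:M pivot_col^T) colE -!scalar_mxM.
move: (z^T *m drsubmx S *m z) (pivot_col^T *m z) => Q B.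
rewrite !mxE /= !mulr1n; ring.
Qed.

Lemma quadmx_dr (z : 'cV[R]_n) : quadmx (drsubmx S) z =
  quadmx schurmx z + (pivot_col^T *m z) 0 0 ^+ 2 / pivot.
Proof.
rewrite /quadmx /schurmx mulmxBr mulmxBl -scalemxAr -scalemxAl.
rewrite mulmxA -(mulmxA _ pivot_col^T z) rowE colE -scalar_mxM.
move: (z^T *m drsubmx S *m z) (pivot_col^T *m z) => Q B.
rewrite !mxE /= !mulr1n; ring.
Qed.

Lemma pivot_gt0 : 0 < pivot.
Proof.
have [_ /(_ (col_mx 1%:M 0))] := Spd.
rewrite quadmx_col /quadmx mulmx0 mulmx0 !mxE mul0r !mulr0 !addr0 expr1n mulr1.
apply; rewrite col_mx_eq0 negb_and; apply/orP; left; apply/eqP => /matrixP/(_ 0 0).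
by rewrite !mxE /= => /eqP; rewrite oner_eq0.
Qed.

Let pivot_neq0 : pivot != 0. Proof. by rewrite gt_eqF// pivot_gt0. Qed.

Lemma schurmx_posdef : real_posdef schurmx.
Proof.
split.
  rewrite /schurmx linearB /= linearZ /= trmx_mul trmxK trmx_drsub.
  by have [-> _] := Spd.
(* For fixed [z] this first coordinate minimizes the form of S, and the minimum is the form of the
   Schur complement at [z]. *)
move=> z z0; have [_ /(_ (col_mx (- (pivot_col^T *m z) 0 0 / pivot)%:M z))] := Spd.
rewrite quadmx_col quadmx_dr; set b := (pivot_col^T *m z) 0 0.
have -> : pivot * (- b / pivot) ^+ 2 + 2 * (b * (- b / pivot)) +
    (quadmx schurmx z + b ^+ 2 / pivot) = quadmx schurmx z by field.
by apply; rewrite col_mx_eq0 negb_and z0 orbT.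
Qed.

(** One step of block elimination: S = U^T D U with U unit triangular and V its inverse. The
    determinant and the inverse of S are both read off from it. *)
Let U := block_mx (1%:M : 'M[R]_1) (pivot^-1 *: pivot_col^T) 0 (1%:M : 'M[R]_n).
Let V := block_mx (1%:M : 'M[R]_1) (- (pivot^-1 *: pivot_col^T)) 0 (1%:M : 'M[R]_n).
Let D := block_mx (pivot%:M : 'M[R]_1) 0 0 schurmx.

Let trZ (a : R) (z : 'cV[R]_n) : (a *: z^T)^T = a *: z.
Proof. by apply/matrixP => i j; rewrite !mxE. Qed.

Let SUDU : S = U^T *m D *m U.
Proof.
rewrite {1}SE /U /D tr_block_mx trZ !mulmx_block !trmx1 !trmx0.
rewrite !mul1mx !mul0mx !mulmx0 !mulmx1 !addr0 !add0r.
rewrite mul_scalar_mx mul_mx_scalar scalerA mulfV// scale1r.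
rewrite !scalerA mulfV// scale1r -scalemxAr; congr block_mx.
by rewrite /schurmx addrC subrK.
Qed.

Lemma det_schur : \det S = pivot * \det schurmx.
Proof.
rewrite {1}SUDU !det_mulmx det_tr /U /D !det_ublock !det1 det_scalar1.
by rewrite !mul1r mulr1.
Qed.

Let UV : U *m V = 1%:M.
Proof.
rewrite /U /V mulmx_block !mulmx1 !mul1mx !mulmx0 !mul0mx !addr0 add0r addNr.
by rewrite -scalar_mx_block.
Qed.

(** The inverse is V D^-1 V^T. The lower block of V^T h is exactly the frequency that remains after
    the first coordinate of a Gaussian integral has been integrated out, so the recursion in
    [gaussian_vector] closes. *)
Lemma quadmx_inv_schur (h : 'cV[R]_(1 + n)) : schurmx \in unitmx ->
  quadmx (invmx S) h = usubmx h 0 0 ^+ 2 / pivot +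
    quadmx (invmx schurmx) (dsubmx h - (usubmx h 0 0 / pivot) *: pivot_col).
Proof.
move=> Su.
pose D' := block_mx ((pivot^-1)%:M : 'M[R]_1) 0 0 (invmx schurmx).
have DD' : D *m D' = 1%:M.
  rewrite /D /D' mulmx_block !mulmx0 !mul0mx !addr0 !add0r.
  by rewrite -scalar_mxM mulfV// mulmxV// -scalar_mx_block.
have SX : S *m (V *m D' *m V^T) = 1%:M.
  rewrite SUDU -!mulmxA (mulmxA U V) UV mul1mx (mulmxA D) DD' mul1mx.
  by rewrite -trmx_mul; move/mulmx1C : UV => ->; rewrite trmx1.
have [Sunit _] := mulmx1_unit SX.
have -> : invmx S = V *m D' *m V^T.
  by rewrite -[RHS](mulKmx Sunit) SX mulmx1.
rewrite /quadmx !mulmxA -(mulmxA _ V^T).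
have Vh : V^T *m h = col_mx (usubmx h) (dsubmx h - (usubmx h 0 0 / pivot) *: pivot_col).
  rewrite -{1}[h]vsubmxK /V tr_block_mx mul_block_col !trmx1 trmx0 !mul1mx mul0mx addr0.
  congr col_mx; rewrite addrC linearN /= trZ mulNmx -scalemxAl.
  by rewrite [usubmx h in LHS]mx11_scalar mul_mx_scalar scalerA mulrC.
have -> : h^T *m V = (V^T *m h)^T by rewrite trmx_mul trmxK.
rewrite Vh tr_col_mx /D' mul_row_block mul_row_col !mulmx0 addr0 add0r.
rewrite [usubmx h]mx11_scalar tr_scalar_mx -!scalar_mxM !mxE /= !mulr1n.
by congr (_ + _); ring.
Qed.

End schur.

Lemma real_posdef_det_gt0 (R : realFieldType) n (S : 'M[R]_n) :
  real_posdef S -> 0 < \det S.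
Proof.
elim: n => [|n IHn] in S * => Spd; first by rewrite det_mx00.
rewrite (@det_schur R n S Spd) mulr_gt0//; first exact: (@pivot_gt0 R n S Spd).
exact/IHn/(@schurmx_posdef R n S Spd).
Qed.

Lemma real_posdef_unitmx (R : realFieldType) n (S : 'M[R]_n) :
  real_posdef S -> S \in unitmx.
Proof. by move=> Spd; rewrite unitmxE unitfE gt_eqF// real_posdef_det_gt0. Qed.

Lemma quadmx_inv_ge0 (R : realFieldType) n (S : 'M[R]_n) (h : 'cV[R]_n) :
  real_posdef S -> 0 <= quadmx (invmx S) h.
Proof.
move=> Spd; have Su := real_posdef_unitmx Spd; have [ST S0] := Spd.
have -> : quadmx (invmx S) h = quadmx S (invmx S *m h).
  by rewrite /quadmx trmx_mul trmx_inv ST -!mulmxA (mulmxA S) mulmxV// mul1mx.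
have [->|v0] := eqVneq (invmx S *m h) 0; last exact/ltW/S0.
by rewrite /quadmx mulmx0 mxE.
Qed.

(** * The Gaussian Fourier integral in dimension n *)

Section measurable_matrix.
Context {R : realType} {d : measure_display} {T : measurableType d}.

Definition measurable_mx p q (X : T -> 'M[R]_(p, q)) : Prop :=
  forall i j, measurable_fun setT (fun t => X t i j).

Lemma measurable_mx_cst p q (A : 'M[R]_(p, q)) : measurable_mx (fun=> A).
Proof. by move=> i j; exact: measurable_cst. Qed.

Lemma measurable_mx_tr p q (X : T -> 'M[R]_(p, q)) :
  measurable_mx X -> measurable_mx (fun t => (X t)^T).
Proof. by move=> mX i j; under eq_fun do rewrite mxE; exact: mX. Qed.

Lemma measurable_mx_mul p q r (X : T -> 'M[R]_(p, q)) (Y : T -> 'M[R]_(q, r)) :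
  measurable_mx X -> measurable_mx Y -> measurable_mx (fun t => X t *m Y t).
Proof.
move=> mX mY i j; under eq_fun do rewrite mxE.
by apply: measurable_sum => k; exact: measurable_funM.
Qed.

Lemma measurable_quadmx n (S : 'M[R]_n) (v : T -> 'cV[R]_n) :
  measurable_mx v -> measurable_fun setT (fun t => quadmx S (v t)).
Proof.
move=> mv.
have mS : measurable_mx (fun=> S : 'M[R]_n) by exact: measurable_mx_cst.
exact: (measurable_mx_mul (measurable_mx_mul (measurable_mx_tr mv) mS) mv 0 0).
Qed.

Lemma measurable_dotmx n (h : 'cV[R]_n) (v : T -> 'cV[R]_n) :
  measurable_mx v -> measurable_fun setT (fun t => (h^T *m v t) 0 0).
Proof.
move=> mv.
have mh : measurable_mx (fun=> h^T) by exact: measurable_mx_cst.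
exact: (measurable_mx_mul mh mv 0 0).
Qed.

Lemma measurable_expR_comp (f : T -> R) :
  measurable_fun setT f -> measurable_fun setT (fun t => expR (f t)).
Proof. by move=> mf; exact: measurableT_comp. Qed.

Lemma measurable_cos_comp (f : T -> R) :
  measurable_fun setT f -> measurable_fun setT (fun t => cos (f t)).
Proof.
move=> mf; apply: (@measurableT_comp _ _ _ _ _ _ (@cos R)) => //.
by apply: continuous_measurable_fun; exact: continuous_cos.
Qed.

End measurable_matrix.

Section gaussian_vector.
Context {R : realType}.

(* The factor [1 + r cos] keeps the integrand nonnegative, so that Tonelli's
   theorem applies, and its shape is preserved when one coordinate is integrated
   out.  The first exponential undoes the standard normal density. *)
Definition fourier_integrand n (S : 'M[R]_n) (h : 'cV[R]_n) (r c : R)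
    (v : 'cV[R]_n) : R :=
  (1 + r * cos ((h^T *m v) 0 0 + c)) *
  (expR (quadmx 1%:M v / 2) * expR (- (quadmx S v / 2))).

Lemma fourier_integrand_ge0 n (S : 'M[R]_n) h r c v : `|r| <= 1 ->
  0 <= fourier_integrand S h r c v.
Proof.
move=> r1; rewrite mulr_ge0 ?mulr_ge0 ?expR_ge0//.
set x := cos _.
have : `|r * x| <= 1.
  by rewrite normrM -[leRHS]mulr1 ler_pM// ler_norml cos_geN1 cos_le1.
by rewrite ler_norml => /andP[+ _]; lra.
Qed.

Lemma measurable_fourier_integrand d (T : measurableType d) n (S : 'M[R]_n)
    (h : 'cV[R]_n) r c (v : T -> 'cV[R]_n) : measurable_mx v ->
  measurable_fun setT (fun t => fourier_integrand S h r c (v t)).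
Proof.
move=> mv; apply: measurable_funM.
  apply: measurable_funD => //; apply: measurable_funM => //.
  apply: measurable_cos_comp; apply: measurable_funD => //.
  exact: measurable_dotmx.
apply: measurable_funM; apply: measurable_expR_comp.
  by apply: measurable_funM => //; exact: measurable_quadmx.
apply: measurable_funN; apply: measurable_funM => //; exact: measurable_quadmx.
Qed.

(** The quantifier order matters: one vector [v] serves every S. It has independent standard normal
    coordinates; integrating out the first one replaces S by its Schur complement, changes [h] and
    [r], and leaves [c] alone, which is an instance in dimension n. *)
Lemma gaussian_vector n : exists (d : measure_display) (T : measurableType d)
    (P : probability T R) (v : T -> 'cV[R]_n), measurable_mx v /\
  forall (S : 'M[R]_n) (h : 'cV[R]_n) (r c : R), real_posdef S -> `|r| <= 1 ->
  (\int[P]_t (fourier_integrand S h r c (v t))%:E =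
   ((Num.sqrt (\det S))^-1 *
    (1 + r * expR (- (quadmx (invmx S) h / 2)) * cos c))%:E)%E.
Proof.
elim: n => [|n [d [T [P [v [mv IHv]]]]]].
  exists _, unit, (@dirac _ unit tt R), (fun=> 0); split.
    by move=> i j; exact: measurable_cst.
  move=> S h r c _ r1.
  rewrite integral_cst//= diracT mule1 /fourier_integrand.
  rewrite /quadmx !mulmx0 det_mx00 [h]flatmx0 trmx0 !mul0mx !mxE.
  by rewrite mul0r oppr0 expR0 sqrtr1 invr1 add0r !mul1r !mulr1.
exists _, (measurableTypeR R * T)%type, (normal_prob 0 1 \x P)%E,
  (fun z => col_mx (z.1%:M : 'M[R]_1) (v z.2) : 'cV[R]_(1 + n)).
have mw : measurable_mx (fun z : measurableTypeR R * T =>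
    col_mx (z.1%:M : 'M[R]_1) (v z.2) : 'cV[R]_(1 + n)).
  move=> i j; case: (split_ordP i) => k ->.
    under eq_fun do rewrite col_mxEu mxE.
    rewrite !ord1 eqxx /=; under eq_fun do rewrite mulr1n.
    exact: measurable_fst.
  under eq_fun do rewrite col_mxEd.
  exact: (measurableT_comp (mv k j) measurable_snd).
split => //; rewrite -[n.+1]/(1 + n)%N => S h r c Spd r1.
rewrite fubini_tonelli2; last 2 first.
- by apply/measurable_EFinP; exact: measurable_fourier_integrand.
- by move=> z; rewrite lee_fin fourier_integrand_ge0.
pose s := pivot S; pose b := pivot_col S.
have s0 : 0 < s := pivot_gt0 Spd.
pose h0 := usubmx h 0 0.
pose h' := dsubmx h - (h0 / s) *: b.
(* The damping due to the first coordinate goes into [r]; the new value is still at most 1 in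
   absolute value, so the integrand stays nonnegative. *)
pose r' := r * expR (- (h0 ^+ 2 / (2 * s))).
have r'1 : `|r'| <= 1.
  rewrite normrM -[leRHS]mulr1 ler_pM// ger0_norm ?expR_ge0//.
  by rewrite -[leRHS]expR0 ler_expR oppr_le0 divr_ge0 ?sqr_ge0// mulr_ge0// ltW.
have Spd' := schurmx_posdef Spd.
transitivity (\int[P]_t (((Num.sqrt s)^-1)%:E *
    (fourier_integrand (schurmx S) h' r' c (v t))%:E))%E.
  apply: eq_integral => t _; rewrite /fubini_G /=.
  set z := v t; pose bz := (b^T *m z) 0 0.
  pose A := expR (quadmx 1%:M z / 2) * expR (- (quadmx (drsubmx S) z / 2)).
  pose hz := ((dsubmx h)^T *m z) 0 0.
  pose W (u : R) :=
    (1 + r * cos (h0 * u + (hz + c))) * expR (u ^+ 2 / 2) * gauss_weight s bz u.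
  transitivity
    (A%:E * \int[normal_prob 0 1]_(u in [set: measurableTypeR R]) (W u)%:E)%E.
    have mF : measurable_fun [set: measurableTypeR R] (fun u => (W u)%:E).
      apply/measurable_EFinP; apply: measurable_funM.
        apply: measurable_funM.
          apply: measurable_funD => //; apply: measurable_funM => //.
          apply: measurable_cos_comp.
          apply: measurable_funD; last exact: measurable_cst.
          by apply: measurable_funM; [exact: measurable_cst|exact: measurable_id].
        apply: measurable_expR_comp; apply: measurable_funM; last exact: measurable_cst.
        by apply: measurable_funX; exact: measurable_id.
      exact: measurable_gauss_weight.
    have F0 (u : measurableTypeR R) : (0 <= (W u)%:E)%E.
      rewrite lee_fin !mulr_ge0 ?expR_ge0//.
      set x := cos _.
      have : `|r * x| <= 1.
        by rewrite normrM -[leRHS]mulr1 ler_pM// ler_norml cos_geN1 cos_le1.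
      by rewrite ler_norml => /andP[+ _]; lra.
    have A0 : (0 <= A%:E)%E by rewrite lee_fin mulr_ge0 ?expR_ge0.
    rewrite -(@ge0_integralZl _ _ _ (normal_prob 0 1) _ measurableT _ mF A%:E
      (fun u _ => F0 u) A0).
    apply: eq_integral => u _; rewrite -EFinM; congr EFin.
      rewrite /fourier_integrand /W.
      have -> : (h^T *m (col_mx u%:M z : 'cV[R]_(1 + n))) 0 0 = h0 * u + hz.
        rewrite -{1}[h]vsubmxK tr_col_mx mul_row_col mxE; congr (_ + _).
        by rewrite mul_mx_scalar mxE mxE mulrC.
      have -> : quadmx 1%:M (col_mx u%:M z : 'cV[R]_(1 + n)) = u ^+ 2 + quadmx 1%:M z.
        rewrite /quadmx !mulmx1 tr_col_mx mul_row_col mxE; congr (_ + _).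
        by rewrite tr_scalar_mx -scalar_mxM mxE eqxx mulr1n.
      rewrite (quadmx_col Spd) -/b -/s -/bz /A /gauss_weight.
      rewrite [X in expR X * _]mulrDl expRD -!addrA.
      rewrite (_ : - ((s * u ^+ 2 + (2 * (bz * u) + quadmx (drsubmx S) z)) / 2) =
        - (s * u ^+ 2 / 2 + bz * u) + - (quadmx (drsubmx S) z / 2)); last by field.
      by rewrite expRD addrA; ring.
  rewrite integral_normal_cos// -!EFinM; congr EFin.
  rewrite /A /fourier_integrand quadmx_dr -/b -/s -/bz.
  have -> : (h'^T *m z) 0 0 = hz - h0 * bz / s.
    rewrite /h' linearB /= mulmxBl mxE [X in _ + X]mxE; congr (_ - _).
    rewrite (_ : ((h0 / s) *: b)^T = (h0 / s) *: b^T); last first.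
      by apply/matrixP => i j; rewrite !mxE.
    by rewrite -scalemxAl mxE mulrAC.
  rewrite mulrDl opprD expRD.
  (* The factor exp (bz^2 / (2 s)) created by the integral over [u] cancels the difference between
     the forms of [drsubmx S] and of the Schur complement. *)
  have := expRxMexpNx_1 (bz ^+ 2 / s / 2).
  rewrite (_ : bz ^+ 2 / (2 * s) = bz ^+ 2 / s / 2); last by field; rewrite gt_eqF.
  rewrite -/r' (addrAC hz c) -/r'.
  move: (expR (bz ^+ 2 / s / 2)) (expR (- (bz ^+ 2 / s / 2))) => x y xy.
  move: (expR (quadmx 1%:M z / 2)) (expR (- (quadmx (schurmx S) z / 2))) => p q.
  rewrite -/r'; move: (1 + _) => f.
  transitivity ((x * y) * ((Num.sqrt s)^-1 * (f * (p * q)))); first by ring.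
  by rewrite xy mul1r.
rewrite ge0_integralZl//.
- rewrite IHv// -EFinM; congr EFin.
  rewrite (det_schur Spd) -/s sqrtrM ?(ltW s0)// invfM -mulrA.
  rewrite (quadmx_inv_schur Spd) ?real_posdef_unitmx// -/s -/b -/h0 -/h'.
  rewrite [in RHS]mulrDl opprD expRD.
  rewrite (_ : h0 ^+ 2 / s / 2 = h0 ^+ 2 / (2 * s)); last by field; rewrite gt_eqF.
  by rewrite /r' !mulrA.
- by apply/measurable_EFinP; exact: measurable_fourier_integrand.
- by move=> t _; rewrite lee_fin fourier_integrand_ge0.
Qed.

End gaussian_vector.

(** * Second moment kernels of random fields *)

Section square_integrable_product.
Context d (T : measurableType d) (R : realType).
Variables (mu : {measure set T -> \bar R}) (f g : T -> R).
Hypotheses (mf : measurable_fun setT f) (mg : measurable_fun setT g).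
Hypotheses (f2 : (\int[mu]_x (f x * f x)%:E < +oo)%E)
  (g2 : (\int[mu]_x (g x * g x)%:E < +oo)%E).

Lemma integrable_mul_sqr : mu.-integrable setT (fun x => (f x * g x)%:E).
Proof.
have mfg : measurable_fun setT (fun x => f x * g x) by exact: measurable_funM.
apply/integrableP; split; first exact/measurable_EFinP.
apply: (@le_lt_trans _ _ (\int[mu]_x ((f x * f x)%:E + (g x * g x)%:E))%E).
  apply: ge0_le_integral => //.
  - by do 2 apply: measurableT_comp => //.
  - by apply: emeasurable_funD; apply/measurable_EFinP; exact: measurable_funM.
  - move=> x _; rewrite -EFinD lee_fin normrM.
    have := sqr_ge0 (`|f x| - `|g x|); have := sqr_ge0 (`|f x|).
    have := sqr_ge0 (`|g x|).
    have := real_normK (num_real (f x)); have := real_normK (num_real (g x)).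
    nra.
rewrite ge0_integralD//.
- exact: lte_add_pinfty.
- by move=> x _; rewrite lee_fin -expr2 sqr_ge0.
- by apply/measurable_EFinP; exact: measurable_funM.
- by move=> x _; rewrite lee_fin -expr2 sqr_ge0.
- by apply/measurable_EFinP; exact: measurable_funM.
Qed.

End square_integrable_product.

Section sigT_measurable.
Variables (d_ : nat -> measure_display) (S_ : forall n, measurableType (d_ n)).

(** The terms of a series of kernels come with unrelated probability spaces; their disjoint union is
    where a randomly chosen term can live. *)
Definition sigT_space : Type := {n : nat & S_ n}.

Definition sigT_display : measure_display. Proof. exact: default_measure_display. Qed.

Definition sigT_measurable (A : set sigT_space) : Prop :=
  forall n, measurable [set s : S_ n | A (existT (fun n => S_ n : Type) n s)].

HB.instance Definition _ := gen_eqMixin sigT_space.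
HB.instance Definition _ := gen_choiceMixin sigT_space.
HB.instance Definition _ :=
  isPointed.Build sigT_space (existT (fun n => S_ n : Type) 0%N point).

Let sigT0 : sigT_measurable set0. Proof. by move=> n; exact: measurable0. Qed.
Let sigTC A : sigT_measurable A -> sigT_measurable (~` A).
Proof. by move=> mA n; exact/measurableC/mA. Qed.
Let sigT_bigcup (F : (set sigT_space)^nat) :
  (forall k, sigT_measurable (F k)) -> sigT_measurable (\bigcup_k F k).
Proof.
move=> mF n.
rewrite (_ : [set s | _] = \bigcup_k
    [set s : S_ n | F k (existT (fun n => S_ n : Type) n s)]).
  by apply: bigcup_measurable => k _; exact: mF.
by apply/seteqP; split=> s [k _ Fk]; exists k.
Qed.

HB.instance Definition _ := @isMeasurable.Build sigT_display sigT_space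
  sigT_measurable sigT0 sigTC sigT_bigcup.

End sigT_measurable.

Section product_integral.
Context d1 d2 (T1 : measurableType d1) (T2 : measurableType d2) (R : realType).
Variables (m1 : {sigma_finite_measure set T1 -> \bar R})
  (m2 : {sigma_finite_measure set T2 -> \bar R}) (f : T1 -> R) (g : T2 -> R).
Hypotheses (fi : m1.-integrable setT (fun x => (f x)%:E))
  (gi : m2.-integrable setT (fun x => (g x)%:E)).

Lemma integrable_prod_mul :
  (m1 \x m2)%E.-integrable setT (fun z => (f z.1 * g z.2)%:E).
Proof.
have mf : measurable_fun setT f by apply/measurable_EFinP; exact: measurable_int fi.
have mg : measurable_fun setT g by apply/measurable_EFinP; exact: measurable_int gi.
apply/integrable12ltyP => /=.
  apply/measurable_EFinP/measurable_funM.
    exact: (measurableT_comp mf measurable_fst).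
  exact: (measurableT_comp mg measurable_snd).
have [_ fi'] := integrableP _ _ _ fi.
have [_ gi'] := integrableP _ _ _ gi.
rewrite (_ : (\int[m1]_x _)%E =
  (\int[m1]_x `|(f x)%:E| * \int[m2]_y `|(g y)%:E|)%E).
  rewrite lte_mul_pinfty ?integral_ge0//.
  by rewrite ge0_fin_numE ?integral_ge0.
rewrite -ge0_integralZr//; last by apply: integral_ge0.
  apply: eq_integral => x _; rewrite -ge0_integralZl//.
    by apply: eq_integral => y _; rewrite /= normrM EFinM.
  by apply: measurableT_comp => //; exact/measurable_EFinP.
by apply: measurableT_comp => //; exact/measurable_EFinP.
Qed.

Lemma integral_prod_mul : (\int[m1 \x m2]_z (f z.1 * g z.2)%:E =
  \int[m1]_x (f x)%:E * \int[m2]_y (g y)%:E)%E.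
Proof.
rewrite -integral12_prod_meas1; last exact: integrable_prod_mul.
rewrite muleC -(fineK (integrable_fin_num _ gi))//.
rewrite -integralZl//; apply: eq_integral => x _.
rewrite /fubini_F /=.
under eq_integral do rewrite EFinM.
by rewrite integralZl// fineK 1?muleC//; exact: integrable_fin_num.
Qed.

End product_integral.

(* [K _ _ t] is the matrix of second moments of a random field that depends
   measurably on the parameter [t]; joint measurability of the field allows [t]
   to be randomized afterwards. *)
Definition gram_kernel (R : realType) (dT : measure_display)
    (T : measurableType dT) (I : Type) (K : I -> I -> T -> R) : Prop :=
  exists (d : measure_display) (S : measurableType d) (Q : probability S R)
    (W : I -> T * S -> R),
    (forall i, measurable_fun setT (W i)) /\
    forall i k t, (\int[Q]_s (W i (t, s) * W k (t, s))%:E = (K i k t)%:E)%E.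

(** * Closure properties of second moment kernels *)

Section gram_kernel_theory.
Context {R : realType} {dT : measure_display} {T : measurableType dT}.

Lemma eq_gram_kernel (I : Type) (K K' : I -> I -> T -> R) :
  (forall i k t, K i k t = K' i k t) -> gram_kernel K -> gram_kernel K'.
Proof.
move=> KK' [d [S [Q [W [mW KW]]]]]; exists d, S, Q, W; split=> // i k t.
by rewrite KW KK'.
Qed.

(** Kernel values are real, so the diagonal identities say that each section of the field is square
    integrable. *)
Lemma integrable_gram_section (I : Type) d (S : measurableType d)
    (Q : probability S R) (W : I -> T * S -> R) (K : I -> I -> T -> R) :
  (forall i, measurable_fun setT (W i)) ->
  (forall i k t, (\int[Q]_s (W i (t, s) * W k (t, s))%:E = (K i k t)%:E)%E) ->
  forall i k t, Q.-integrable setT (fun s => (W i (t, s) * W k (t, s))%:E).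
Proof.
move=> mW KW i k t; apply: (@integrable_mul_sqr _ _ _ Q
  (fun s => W i (t, s)) (fun s => W k (t, s))).
- exact: (measurableT_comp (mW i) (measurable_pair1 t)).
- exact: (measurableT_comp (mW k) (measurable_pair1 t)).
- by rewrite KW ltry.
- by rewrite KW ltry.
Qed.

Lemma gram_rank1 (I : Type) (f : I -> T -> R) :
  (forall i, measurable_fun setT (f i)) ->
  gram_kernel (fun i k t => f i t * f k t).
Proof.
move=> mf; exists _, unit, (@dirac _ unit tt R), (fun i z => f i z.1); split.
  by move=> i; exact: (measurableT_comp (mf i) measurable_fst).
by move=> i k t /=; rewrite integral_cst//= diracT mule1.
Qed.

Lemma gramM (I : Type) (K K' : I -> I -> T -> R) :
  gram_kernel K -> gram_kernel K' ->
  gram_kernel (fun i k t => K i k t * K' i k t).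
Proof.
move=> [d [S [Q [W [mW KW]]]]] [d' [S' [Q' [W' [mW' KW']]]]].
exists _, (S * S')%type, (Q \x Q')%E,
  (fun i z => W i (z.1, z.2.1) * W' i (z.1, z.2.2)); split.
  move=> i; apply: measurable_funM.
    apply: (measurableT_comp (mW i)) => /=; apply: measurable_fun_pair => //.
    exact: (measurableT_comp measurable_fst measurable_snd).
  apply: (measurableT_comp (mW' i)) => /=; apply: measurable_fun_pair => //.
  exact: (measurableT_comp measurable_snd measurable_snd).
move=> i k t /=.
transitivity (\int[(Q \x Q')%E]_z ((W i (t, z.1) * W k (t, z.1)) *
    (W' i (t, z.2) * W' k (t, z.2)))%:E)%E.
  by apply: eq_integral => z _; congr EFin; rewrite mulrACA.
rewrite (@integral_prod_mul _ _ _ _ _ Q Q' (fun s => W i (t, s) * W k (t, s))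
   (fun s => W' i (t, s) * W' k (t, s))) ?KW ?KW' ?EFinM//.
  exact: integrable_gram_section KW i k t.
exact: integrable_gram_section KW' i k t.
Qed.

(** With [u] the coordinates of A_j eta, this passes from G to the form (A_j eta)^T G (A_k eta); the
    coefficients may depend on the parameter because eta is part of it. *)
Lemma gram_lincomb (I J : Type) (K : I -> I -> T -> R) n
    (e : J -> 'I_n -> I) (u : J -> 'I_n -> T -> R) :
  gram_kernel K -> (forall j p, measurable_fun setT (u j p)) ->
  gram_kernel (fun j k t => \sum_p \sum_q u j p t * u k q t * K (e j p) (e k q) t).
Proof.
move=> [d [S [Q [W [mW KW]]]]] mu.
exists d, S, Q, (fun j z => \sum_p u j p z.1 * W (e j p) z); split.
  move=> j; apply: measurable_sum => p; apply: measurable_funM => //.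
  exact: (measurableT_comp (mu j p) measurable_fst).
move=> j k t /=.
pose g p q s := (u j p t * u k q t * (W (e j p) (t, s) * W (e k q) (t, s)))%:E.
have gi p q : Q.-integrable setT (g p q).
  rewrite /g; under eq_fun do rewrite EFinM.
  apply: integrableZl => //; exact: integrable_gram_section KW _ _ _.
transitivity (\int[Q]_s \sum_p \sum_q g p q s)%E.
  apply: eq_integral => s _.
  rewrite mulr_suml -sumEFin; apply: eq_bigr => p _.
  rewrite mulr_sumr -sumEFin; apply: eq_bigr => q _.
  by rewrite /g; congr EFin; ring.
rewrite integral_sum//; last by move=> p; exact: integrable_sum.
rewrite -sumEFin; apply: eq_bigr => p _.
rewrite integral_sum// -sumEFin; apply: eq_bigr => q _.
rewrite /g; under eq_integral do rewrite EFinM.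
rewrite integralZl// ?KW ?EFinM//; exact: integrable_gram_section KW _ _ _.
Qed.

End gram_kernel_theory.

Section mixture.
Context {R : realType} {d_ : nat -> measure_display}
  {S_ : forall n, measurableType (d_ n)} (Q_ : forall n, probability (S_ n) R).

Definition sigT_in n (s : S_ n) : sigT_space S_ :=
  existT (fun n => S_ n : Type) n s.

Lemma measurable_sigT_in n : measurable_fun setT (@sigT_in n).
Proof. by move=> _ A mA; rewrite setTI; exact: mA. Qed.

HB.instance Definition _ n :=
  isMeasurableFun.Build _ _ _ _ (@sigT_in n) (@measurable_sigT_in n).

Let weight_ge0 n : 0 <= 2^-1 ^+ n.+1 :> R. Proof. exact: exprn_ge0. Qed.

Definition mixture : set (sigT_space S_) -> \bar R :=
  mseries (fun n => mscale (NngNum (weight_ge0 n))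
    (distribution (Q_ n) (@sigT_in n))) 0.

HB.instance Definition _ := Measure.on mixture.

Lemma integral_mixture (f : sigT_space S_ -> \bar R) :
  measurable_fun setT f -> (forall z, 0 <= f z)%E ->
  (\int[mixture]_z f z =
   \sum_(n <oo) (2^-1 ^+ n.+1)%:E * \int[Q_ n]_s f (sigT_in s))%E.
Proof.
move=> mf f0; rewrite ge0_integral_measure_series//.
apply: eq_eseriesr => n _; rewrite ge0_integral_mscale//=.
by rewrite ge0_integral_distribution.
Qed.

Let mixture_setT : mixture setT = 1%E.
Proof.
rewrite /mixture /mseries /mscale /=.
transitivity (\sum_(n <oo) (1 / (2 ^ (n.+1))%:R : R)%:E)%E.
  apply: eq_eseriesr => n _.
  transitivity ((2^-1 ^+ n.+1 : R)%:E * 1)%E.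
    by congr (_ * _)%E; exact: (probability_setT (distribution (Q_ n) (@sigT_in n))).
  by rewrite mule1 natrX exprVn div1r.
have := @cvg_geometric_eseries_half R 1 0; rewrite expr0 divr1 => /cvg_lim <- //.
by apply: eq_eseriesr => n _; rewrite addn1.
Qed.

HB.instance Definition _ := Measure_isProbability.Build _ _ _ mixture mixture_setT.

End mixture.

Lemma measurable_sigT {d_ : nat -> measure_display}
    {S_ : forall n, measurableType (d_ n)} (A : set (sigT_space S_)) :
  (forall n, measurable [set s : S_ n | A (sigT_in s)]) -> measurable A.
Proof. by []. Qed.

Section gram_series.
Context {R : realType} {dT : measure_display} {T : measurableType dT}.

(* Type-valued form of [gram_kernel], from which the witnesses of a sequence of
   kernels can be chosen simultaneously. *)
Record gram_field (I : Type) (K : I -> I -> T -> R) := {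
  gf_display : measure_display;
  gf_space : measurableType gf_display;
  gf_prob : probability gf_space R;
  gf_field : I -> T * gf_space -> R;
  gf_measurable : forall i, measurable_fun setT (gf_field i);
  gf_gram : forall i k t, (\int[gf_prob]_s
    (gf_field i (t, s) * gf_field k (t, s))%:E = (K i k t)%:E)%E }.

Lemma gram_field_of (I : Type) (K : I -> I -> T -> R) :
  gram_kernel K -> gram_field K.
Proof.
move=> /cid[d /cid[S /cid[Q /cid[W [mW KW]]]]].
exact: (Build_gram_field mW KW).
Qed.

Lemma nneseries_cvg (u : nat -> R) (l : R) : (forall n, 0 <= u n) ->
  series u @ \oo --> l -> (\sum_(n <oo) (u n)%:E = l%:E)%E.
Proof.
move=> u0 ul; apply/cvg_lim => //.
have -> : (fun n => \sum_(0 <= k < n) (u k)%:E)%E = EFin \o series u.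
  by apply/funext => n /=; rewrite sumEFin.
exact/cvg_EFin/ul/nearW.
Qed.

(** The domain carries a product sigma-algebra, so measurability is not componentwise by definition.
    The preimage is cut along the countably many tags, and each piece is pulled back through a
    retraction onto one component. *)
Lemma measurable_fun_sigT {d_ : nat -> measure_display}
    {S_ : forall n, measurableType (d_ n)} (d : measure_display)
    (Y : measurableType d) (f : T * sigT_space S_ -> Y) :
  (forall n, measurable_fun setT (fun z : T * S_ n => f (z.1, sigT_in z.2))) ->
  measurable_fun setT f.
Proof.
move=> mf _ B mB; rewrite setTI.
(* Retraction onto component [n], constant off it; it is only evaluated where the tag is [n]. *)
pose r n (z : sigT_space S_) : S_ n :=
  if pselect (projT1 z = n) is left e
  then eq_rect _ (fun n => S_ n : Type) (projT2 z) _ e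
  else point.
have mr n : measurable_fun setT (r n).
  move=> _ A mA; rewrite setTI; apply: measurable_sigT => m.
  have [mn|mn] := pselect (m = n).
    subst m; rewrite (_ : [set s | _] = A)//.
    apply/seteqP; split=> s /=; rewrite /r /=; case: pselect => // e;
    by rewrite (Prop_irrelevance e erefl).
  rewrite (_ : [set s | _] = if `[< A point >] then setT else set0).
    by case: ifP => _; [exact: measurableT|exact: measurable0].
  apply/seteqP; split=> s /=; rewrite /r /=; case: pselect => // _;
  by case: asboolP.
have mtag n : measurable [set z : sigT_space S_ | projT1 z = n].
  apply: measurable_sigT => m; have [mn|mn] := pselect (m = n).
    by rewrite (_ : [set s | _] = setT)//; apply/seteqP; split.
  by rewrite (_ : [set s | _] = set0)//; apply/seteqP; split.
rewrite (_ : f @^-1` B = \bigcup_n ((snd @^-1` [set z | projT1 z = n]) `&`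
    ((fun z => f (z.1, sigT_in (r n z.2))) @^-1` B))).
  apply: bigcup_measurable => n _; apply: measurableI.
    by rewrite -[X in measurable X]setTI; exact: measurable_snd.
  rewrite -[X in measurable X]setTI.
  apply: (measurableT_comp (mf n)
    (_ : measurable_fun setT (fun z => (z.1, r n z.2)))) => //.
  apply: measurable_fun_pair => //.
  exact: (measurableT_comp (mr n) measurable_snd).
have rE z : sigT_in (r (projT1 z) z) = z.
  case: z => n s; rewrite /r /=; case: pselect => // e.
  by rewrite (Prop_irrelevance e erefl).
apply/seteqP; split => [[t z] /= Bz|[t z] [n _ [/= zn]]].
  by exists (projT1 z) => //; split => //=; rewrite rE.
by rewrite -zn rE.
Qed.

Lemma integral_sqr_lin d (S : measurableType d) (mu : {measure set S -> \bar R})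
    (f g : S -> R) (a b A B C : R) :
  measurable_fun setT f -> measurable_fun setT g ->
  (\int[mu]_x (f x * f x)%:E = A%:E)%E -> (\int[mu]_x (g x * g x)%:E = B%:E)%E ->
  (\int[mu]_x (f x * g x)%:E = C%:E)%E ->
  (\int[mu]_x ((a * f x + b * g x) * (a * f x + b * g x))%:E =
   (a ^+ 2 * A + 2 * a * b * C + b ^+ 2 * B)%:E)%E.
Proof.
move=> mf mg fA gB fgC.
have f2 : (\int[mu]_x (f x * f x)%:E < +oo)%E by rewrite fA ltry.
have g2 : (\int[mu]_x (g x * g x)%:E < +oo)%E by rewrite gB ltry.
have ff := integrable_mul_sqr mf mf f2 f2.
have gg := integrable_mul_sqr mg mg g2 g2.
have fg := integrable_mul_sqr mf mg f2 g2.
transitivity (\int[mu]_x ((a ^+ 2)%:E * (f x * f x)%:E +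
    (2 * a * b)%:E * (f x * g x)%:E + (b ^+ 2)%:E * (g x * g x)%:E))%E.
  by apply: eq_integral => x _; rewrite -!EFinM -!EFinD; congr EFin; ring.
rewrite integralD//; [|by apply: integrableD => //; exact: integrableZl|
  exact: integrableZl].
rewrite integralD//; [|exact: integrableZl..].
by rewrite !integralZl// fA gB fgC -!EFinM -!EFinD.
Qed.

(* The field of the sum draws a component [n] with probability [2^-(n+1)] and
   rescales it by [sqrt (2^(n+1))].  Mixed moments are obtained by polarization,
   which keeps all integrands nonnegative. *)
Lemma gram_series (I : Type) (K_ : nat -> I -> I -> T -> R)
    (K : I -> I -> T -> R) : (forall n, gram_kernel (K_ n)) ->
  (forall i k t, series (fun n => K_ n i k t) @ \oo --> K i k t) ->
  gram_kernel K.
Proof.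
move=> gK cK.
pose C n := gram_field_of (gK n).
pose d_ n := gf_display (C n).
pose S_ n : measurableType (d_ n) := gf_space (C n).
pose Q_ n : probability (S_ n) R := gf_prob (C n).
pose W_ n : I -> T * S_ n -> R := @gf_field _ _ (C n).
have mW n i : measurable_fun setT (W_ n i) := @gf_measurable _ _ (C n) i.
have KW n i k t : (\int[Q_ n]_s (W_ n i (t, s) * W_ n k (t, s))%:E =
  (K_ n i k t)%:E)%E := @gf_gram _ _ (C n) i k t.
clearbody W_ Q_ S_ d_; clear -mW KW cK.
pose w n : R := Num.sqrt (2 ^+ n.+1).
pose W i (z : T * sigT_space S_) :=
  w (projT1 z.2) * W_ (projT1 z.2) i (z.1, projT2 z.2).
exists _, (sigT_space S_), (mixture Q_), W.
have mWW i : measurable_fun setT (W i).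
  apply: measurable_fun_sigT => n.
  rewrite /W /=; apply: measurable_funM => //.
  by apply: (measurableT_comp (mW n i)); exact: measurable_fun_pair.
have K_ge0 n i t : 0 <= K_ n i i t.
  rewrite -lee_fin -KW; apply: integral_ge0 => s _.
  by rewrite lee_fin -expr2 sqr_ge0.
have mWt i t : measurable_fun setT (fun z => W i (t, z)).
  exact: (measurableT_comp (mWW i) (measurable_pair1 t)).
have KWab i k t a b :
  (\int[mixture Q_]_z ((a * W i (t, z) + b * W k (t, z)) *
     (a * W i (t, z) + b * W k (t, z)))%:E =
   (a ^+ 2 * K i i t + 2 * a * b * K i k t + b ^+ 2 * K k k t)%:E)%E.
  rewrite integral_mixture; last 2 first.
  - by apply/measurable_EFinP/measurable_funM; apply: measurable_funD;
      apply: measurable_funM.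
  - by move=> z; rewrite lee_fin -expr2 sqr_ge0.
  have Kab n : (\int[Q_ n]_s ((a * W_ n i (t, s) + b * W_ n k (t, s)) *
     (a * W_ n i (t, s) + b * W_ n k (t, s)))%:E =
     (a ^+ 2 * K_ n i i t + 2 * a * b * K_ n i k t + b ^+ 2 * K_ n k k t)%:E)%E.
    apply: integral_sqr_lin => //.
      exact: (measurableT_comp (mW n i) (measurable_pair1 t)).
    exact: (measurableT_comp (mW n k) (measurable_pair1 t)).
  rewrite -(@nneseries_cvg (fun n => a ^+ 2 * K_ n i i t +
      2 * a * b * K_ n i k t + b ^+ 2 * K_ n k k t)).
  - apply: eq_eseriesr => n _.
    rewrite -Kab -ge0_integralZl//.
    + apply: eq_integral => s _; rewrite -EFinM /W /=; congr EFin.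
      rewrite 2!(mulrCA _ (w n)) -mulrDr mulrACA -expr2.
      by rewrite sqr_sqrtr ?exprn_ge0// exprVn mulKf ?expf_neq0.
    + apply/measurable_EFinP/measurable_funM; apply: measurable_funD;
        apply: measurable_funM => //;
        exact: (measurableT_comp (mWt _ t) (@measurable_sigT_in _ _ n)).
    + by move=> s _; rewrite lee_fin -expr2 sqr_ge0.
  - move=> n; rewrite -lee_fin -Kab; apply: integral_ge0 => s _.
    by rewrite lee_fin -expr2 sqr_ge0.
  - rewrite (_ : series _ = (fun n =>
       a ^+ 2 * series (fun n => K_ n i i t) n +
       2 * a * b * series (fun n => K_ n i k t) n +
       b ^+ 2 * series (fun n => K_ n k k t) n)).
      apply: cvgD; [apply: cvgD|]; (apply: cvgM; [exact: cvg_cst|exact: cK]).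
    apply/funext => n; rewrite /series /= !mulr_sumr -!big_split /=.
    by apply: eq_bigr.
have Kii i t : (\int[mixture Q_]_z (W i (t, z) * W i (t, z))%:E = (K i i t)%:E)%E.
  transitivity (1 ^+ 2 * K i i t + 2 * 1 * 0 * K i i t + 0 ^+ 2 * K i i t)%:E.
    rewrite -KWab; apply: eq_integral => z _.
    by rewrite !mul1r !mul0r !addr0.
  by congr EFin; ring.
split => // i k t.
have WWi : (mixture Q_).-integrable setT (fun z => (W i (t, z) * W k (t, z))%:E).
  by apply: (@integrable_mul_sqr _ _ _ _ (fun z => W i (t, z))
    (fun z => W k (t, z))) => //; rewrite Kii ltry.
(* Polarization at a = b = 1: with the diagonal moments known, the mixed moment is the only
   unknown. *)
have := KWab i k t 1 1.
rewrite (integral_sqr_lin 1 1 (mWt i t) (mWt k t) (Kii i t) (Kii k t)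
  (esym (fineK (integrable_fin_num measurableT WWi)))) => -[E].
rewrite -(fineK (integrable_fin_num measurableT WWi)); congr EFin.
by move: E; lra.
Qed.
End gram_series.

Section gram_kernel_ops.
Context {R : realType} {dT : measure_display} {T : measurableType dT} {I : Type}.
Implicit Types K : I -> I -> T -> R.

Lemma gram_cst (c : R) : 0 <= c -> gram_kernel (fun (i k : I) (t : T) => c).
Proof.
move=> c0.
apply: (eq_gram_kernel _ (@gram_rank1 R _ T I (fun _ _ => Num.sqrt c) _)) => //.
by move=> i k t; rewrite -expr2 sqr_sqrtr.
Qed.

(** A sum is a series with two nonzero terms, so the mixture construction is reused. *)
Lemma gramD K K' : gram_kernel K -> gram_kernel K' ->
  gram_kernel (fun i k t => K i k t + K' i k t).
Proof.
move=> gK gK'.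
apply: (@gram_series _ _ _ _ (fun n => if n is n'.+1 then
   if n' is _.+1 then (fun _ _ _ => 0) else K' else K)).
  by case=> [|[|n]] //; exact: gram_cst.
move=> i k t; apply: cvg_near_cst; near=> n.
have /subnK <- : (2 <= n)%N by near: n; exists 2%N.
rewrite addnC /series /= big_nat_recl// big_nat_recl//= big1 ?addr0//.
Unshelve. all: by end_near. Qed.

Lemma gramZ (c : R) K : 0 <= c -> gram_kernel K ->
  gram_kernel (fun i k t => c * K i k t).
Proof. by move=> c0; exact/gramM/gram_cst. Qed.

Lemma gramX K n : gram_kernel K -> gram_kernel (fun i k t => K i k t ^+ n).
Proof.
move=> gK; elim: n => [|n IHn]; first exact: gram_cst.
apply: (eq_gram_kernel _ (gramM gK IHn)) => i k t.
by rewrite exprS.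
Qed.

Lemma gram_expR K : gram_kernel K -> gram_kernel (fun i k t => expR (K i k t)).
Proof.
move=> gK; apply: (@gram_series _ _ _ _ (fun n i k t => exp_coeff (K i k t) n)).
  move=> n; apply: (eq_gram_kernel _ (@gramZ n`!%:R^-1 _ _ (gramX n gK))) => //.
  by move=> i k t; rewrite /exp_coeff /= mulrC.
by move=> i k t; exact: is_cvg_series_exp_coeff.
Qed.

Lemma gram_cos (g : I -> T -> R) : (forall i, measurable_fun setT (g i)) ->
  gram_kernel (fun i k t => cos (g i t - g k t)).
Proof.
move=> mg.
have mcos : measurable_fun setT (@cos R).
  by apply: continuous_measurable_fun; exact: continuous_cos.
have msin : measurable_fun setT (@sin R).
  by apply: continuous_measurable_fun; exact: continuous_sin.
apply: (eq_gram_kernel _ (gramD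
  (@gram_rank1 _ _ _ _ (fun i t => cos (g i t)) _)
  (@gram_rank1 _ _ _ _ (fun i t => sin (g i t)) _))).
- by move=> i k t; rewrite cosB.
- by move=> i; exact: measurableT_comp.
- by move=> i; exact: measurableT_comp.
Qed.

End gram_kernel_ops.

(** * From second moment kernels to centred fields, and back *)

Section fair_sign.
Context {R : realType}.

Definition fair_sign (b : bool) : R := (-1) ^+ b.

Lemma integral_fair_sign : (\int[bernoulli_prob (2^-1 : R)]_b (fair_sign b)%:E = 0)%E.
Proof.
have half : 0 <= (2^-1 : R) <= 1 by apply/andP; split; lra.
(* The Bernoulli integral formula is for nonnegative functions, so the sign is written as 1 - 2
   b. *)
rewrite (_ : (fun b => _) = ((cst 1 : bool -> _) \- (fun b => 2%:E * (b%:R : R)%:E))%E).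
  have i1 : (bernoulli_prob (2^-1 : R)).-integrable setT
      (fun b => 2%:E * (b%:R : R)%:E)%E.
    apply/integrableP; split => //.
    under eq_integral => b _ do rewrite gee0_abs ?mule_ge0 ?lee_fin//.
    rewrite integral_bernoulli_prob; last 2 first.
      by [].
      by move=> b; rewrite mule_ge0// lee_fin.
    by rewrite /= ltry.
  rewrite integralB//; last exact: finite_measure_integrable_cst.
  rewrite integral_cst//= probability_setT mule1.
  rewrite integral_bernoulli_prob; last 2 first.
    by [].
    by move=> b; rewrite mule_ge0// lee_fin.
  rewrite /=.
  by rewrite !mulr0 addr0 mulr1 mulVf// -EFinD subrr.
apply/funext => -[] /=; rewrite /fair_sign ?expr1 ?expr0 /=.
  by apply: (congr1 EFin (_ : -1 = 1 - 2 * 1)); lra.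
by apply: (congr1 EFin (_ : 1 = 1 - 2 * 0)); lra.
Qed.

End fair_sign.

Lemma Lfun2_sqr d (T : measurableType d) (R : realType)
    (mu : {measure set T -> \bar R}) (f : T -> R) :
  measurable_fun setT f -> (\int[mu]_x (f x * f x)%:E < +oo)%E ->
  f \in Lfun mu 2%:E.
Proof.
move=> mf f2; rewrite inE; apply/andP; split; rewrite inE//=.
rewrite /finite_norm unlock /Lnorm poweR_lty//.
apply: le_lt_trans f2; rewrite le_eqVlt; apply/orP; left; apply/eqP.
apply: eq_integral => x _; congr EFin.
by rewrite powR_mulrn// real_normK ?num_real// expr2.
Qed.

Section cross_covariance_gram.
Context {R : realType} {dT : measure_display} {T : measurableType dT} {d m : nat}.

(** Tonelli gives the diagonal moments; their finiteness makes all products integrable, and Fubini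
    then gives the mixed ones. The independent sign squares to 1, so it centres the field without
    changing products. *)
Lemma gram_cross_covariance (mu : probability T R)
    (K : 'cV[R]_d * 'I_m -> 'cV[R]_d * 'I_m -> T -> R)
    (C : 'cV[R]_d -> 'cV[R]_d -> 'M[R]_m) :
  gram_kernel K ->
  (forall x y j k,
    (\int[mu]_t (K (x, j) (y, k) t)%:E = (C x y j k)%:E)%E) ->
  cross_covariance (fun x y => complexmx (C x y)).
Proof.
move=> [dS [S [Q [W [mW KW]]]]] KC.
pose P1 : probability (T * S)%type R := (mu \x Q)%E.
have W2 i : (\int[P1]_z (W i z * W i z)%:E < +oo)%E.
  case: i => x j.
  rewrite fubini_tonelli1 /fubini_F /=.
  - under eq_integral do rewrite KW.
    by rewrite KC ltry.
  - by apply/measurable_EFinP; exact: measurable_funM.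
  - by move=> z; rewrite lee_fin -expr2 sqr_ge0.
have WWi i k : P1.-integrable setT (fun z => (W i z * W k z)%:E).
  exact: integrable_mul_sqr.
have WWE x y j k : (\int[P1]_z (W (x, j) z * W (y, k) z)%:E = (C x y j k)%:E)%E.
  rewrite -integral12_prod_meas1 /fubini_F//=.
  by under eq_integral do rewrite KW.
pose P : probability (T * S * bool)%type R := (P1 \x bernoulli_prob (2^-1 : R))%E.
pose Z (x : 'cV[R]_d) j (w : T * S * bool) : R := W (x, j) w.1 * fair_sign w.2.
have mfs : measurable_fun setT (@fair_sign R) by [].
have mZ x j : measurable_fun setT (Z x j).
  apply: measurable_funM; first exact: (measurableT_comp (mW _) measurable_fst).
  exact: (measurableT_comp mfs measurable_snd).
have ZZE x y j k : (\int[P]_w (Z x j w * Z y k w)%:E = (C x y j k)%:E)%E.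
  transitivity (\int[P]_w (W (x, j) w.1 * W (y, k) w.1 * cst 1 w.2)%:E)%E.
    apply: eq_integral => w _; congr EFin; rewrite /Z mulrACA; congr (_ * _).
    by rewrite -expr2 /fair_sign sqrr_sign.
  rewrite (@integral_prod_mul _ _ _ _ _ P1 _
    (fun z => W (x, j) z * W (y, k) z) (cst 1))//; last first.
    exact: finite_measure_integrable_cst.
  transitivity ((C x y j k)%:E * \int[bernoulli_prob (2^-1 : R)]_b cst 1%E b)%E.
    by rewrite WWE.
  by rewrite integral_cst//= probability_setT !mule1.
have Z2 x j : Z x j \in Lfun P 2%:E.
  by apply: Lfun2_sqr => //; rewrite ZZE ltry.
have Z0 x j : (\int[P]_w (Z x j w)%:E = 0)%E.
  have Wi : P1.-integrable setT (EFin \o W (x, j)).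
    apply/Lfun1_integrable/Lfun_subset12; last exact: Lfun2_sqr.
    exact: fin_num_measure.
  rewrite (@integral_prod_mul _ _ _ _ _ P1 _ (fun z => W (x, j) z) (@fair_sign R))//.
    by rewrite integral_fair_sign mule0.
  apply/integrableP; split => //.
  rewrite (_ : (fun x => _) = cst 1%E).
    by rewrite integral_cst//= probability_setT mule1 ltry.
  by apply/funext => b /=; rewrite /fair_sign normrX normrN1 expr1n.
exists _, (T * S * bool)%type, P, (fun x j w => (Z x j w)%:C%C); split.
- move=> x j; split => //=.
  by have := @Lfun_cst _ (T * S * bool)%type R P 0 2; exact.
- move=> x j; rewrite /cexpectation !unlock /= Z0.
  by rewrite integral0.
- move=> x y j k; rewrite /cexpectation !unlock /=.
  rewrite !mxE.
  congr (_ +i* _)%C.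
    under eq_integral do rewrite oppr0 !mulr0 subr0.
    by rewrite ZZE.
  under eq_integral do rewrite oppr0 mulr0 mul0r addr0.
  by rewrite integral0.
Qed.

End cross_covariance_gram.

Section cross_covariance_is_gram.
Context {R : realType} {dT : measure_display} {T : measurableType dT}.

Lemma integrable_Lfun2_mul d (S : measurableType d) (Q : probability S R)
    (f g : S -> R) : f \in Lfun Q 2%:E -> g \in Lfun Q 2%:E ->
  Q.-integrable setT (fun s => (f s * g s)%:E).
Proof. by move=> f2 g2; apply/Lfun1_integrable; exact: Lfun2_mul_Lfun1. Qed.

Lemma gram_Lfun2 (I : Type) d (S : measurableType d) (Q : probability S R)
    (f : I -> S -> R) : (forall i, f i \in Lfun Q 2%:E) ->
  gram_kernel (fun i k (_ : T) => fine (\int[Q]_s (f i s * f k s)%:E)%E).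
Proof.
move=> f2; exists d, S, Q, (fun i z => f i z.2); split.
  move=> i; have := f2 i; rewrite inE => /andP[/[!inE] mf _].
  exact: (measurableT_comp mf measurable_snd).
move=> i k t /=; rewrite fineK//.
by apply: integrable_fin_num => //; exact: integrable_Lfun2_mul.
Qed.

(** For a real covariance only the real part of Z_j conj(Z_k) counts, and it is the sum of the
    products of real parts and of imaginary parts: two real kernels. *)
Lemma cross_covariance_gram (d l : nat) (G : 'cV[R]_d -> 'cV[R]_d -> 'M[R]_l) :
  cross_covariance (fun x y => complexmx (G x y)) ->
  gram_kernel (fun (i k : 'cV[R]_d * 'I_l) (_ : T) => G i.1 k.1 i.2 k.2).
Proof.
move=> [dS [S [P [Z [Z2 _ ZG]]]]].
pose re (i : 'cV[R]_d * 'I_l) w := complex.Re (Z i.1 i.2 w).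
pose im (i : 'cV[R]_d * 'I_l) w := complex.Im (Z i.1 i.2 w).
have re2 i : re i \in Lfun P 2%:E by have [] := Z2 i.1 i.2.
have im2 i : im i \in Lfun P 2%:E by have [] := Z2 i.1 i.2.
apply: (eq_gram_kernel _ (gramD (gram_Lfun2 re2) (gram_Lfun2 im2))) => i k _.
have := ZG i.1 k.1 i.2 k.2; rewrite /cexpectation /complexmx mxE unlock => -[-> _].
have rr := integrable_Lfun2_mul (re2 i) (re2 k).
have ii := integrable_Lfun2_mul (im2 i) (im2 k).
rewrite -fineD ?(integrable_fin_num _ rr) ?(integrable_fin_num _ ii)//.
rewrite -integralD//; congr fine; apply: eq_integral => w _.
rewrite -EFinD; congr EFin; rewrite /re /im.
by case: (Z i.1 i.2 w) => a b; case: (Z k.1 k.2 w) => a' b' /=; ring.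
Qed.

End cross_covariance_is_gram.

(** * Normal scale mixtures and the spectral representation *)

Lemma real_posdef_complexmx (R : realType) n (S : 'M[R]_n) :
  strict_posdefmx (complexmx S) -> real_posdef S.
Proof.
move=> [Sherm Spos]; split.
  move/is_hermitianmxP : Sherm; rewrite expr0 scale1r => /matrixP SE.
  apply/matrixP => i j; have := SE j i; rewrite !mxE /=.
  by move=> /(congr1 (@complex.Re R)) /= ->.
move=> v v0; have := Spos (complexmx v).
have -> : ((complexmx v)^T *m complexmx S *m map_mx Num.conj (complexmx v)) 0 0 =
    (quadmx S v)%:C%C.
  have -> : map_mx Num.conj (complexmx v) = complexmx v.
    by apply/matrixP => i j; rewrite !mxE /=; congr (_ +i* _)%C; rewrite oppr0.
  by rewrite /complexmx map_trmx -!map_mxM mxE.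
rewrite ltcR; apply; apply: contra v0 => /eqP/matrixP vE.
by apply/eqP/matrixP => i j; have := vE i j; rewrite !mxE => /(congr1 (@complex.Re R)).
Qed.

(* The absolute value keeps the exponential bounded, so that the mixing law may be
   taken on the whole real line. *)
Lemma normal_scale_mixture_prob (R : realType) (phi : R -> R) :
  normal_scale_mixture phi ->
  exists (P : probability (measurableTypeR R) R) (c : R), 0 <= c /\
    forall h, 0 <= h ->
    (c%:E * \int[P]_(a in [set: measurableTypeR R])
      (expR (- `|a| * h ^+ 2))%:E = (phi h)%:E)%E.
Proof.
move=> [F hF].
pose D : set (measurableTypeR R) := `[0%R, +oo[%classic.
have mD : measurable D by exact: measurable_itv.
have mE (h : R) : measurable_fun setT (fun a : measurableTypeR R =>
    (expR (- `|a| * h ^+ 2))%:E).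
  apply/measurable_EFinP/measurable_expR_comp/measurable_funM => //.
  by apply: measurable_funN; exact: (@normr_measurable R setT).
have FD : F D = (phi 0)%:E.
  rewrite -hF//; under eq_integral do rewrite expr0n mulr0 expR0.
  by rewrite integral_cst// mul1e.
pose c := phi 0.
have c0 : 0 <= c by rewrite -lee_fin -FD.
have FDabs (h : R) : 0 <= h ->
    (\int[F]_(a in D) (expR (- `|a| * h ^+ 2))%:E = (phi h)%:E)%E.
  move=> h0; rewrite -(hF h h0); apply: eq_integral => a.
  by rewrite inE /D /= in_itv /= andbT => a0; rewrite ger0_norm.
(* [mnormalize] returns [dirac point] for zero or infinite mass. Here the mass is phi 0, hence
   finite; zero mass forces [phi] to vanish on [0, +oo[ and is the case c = 0. *)
pose P : probability (measurableTypeR R) R := mnormalize (mrestr F mD) (dirac point).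
exists P, c; split => // h h0; rewrite -FDabs//.
have [c00|cN0] := eqVneq c 0.
  rewrite c00 mul0e; apply/esym/null_set_integral => //.
    exact: measurable_funTS.
  by rewrite FD -/c c00.
have PE A : P A = ((c^-1)%:E * F (A `&` D))%E.
  have FT : mrestr F mD setT = c%:E by rewrite -[RHS]FD /mrestr setTI.
  rewrite /P /= /mnormalize; case: ifPn => [/orP[]/eqP FT'|_].
  - by have [] := etrans (esym FT') FT => /esym/eqP; rewrite (negbTE cN0).
  - by have := etrans (esym FT') FT.
  - by rewrite muleC; congr ((_^-1)%:E * _)%E; exact: (congr1 fine FT).
have PDC : P (~` D) = 0%E by rewrite PE setICl measure0 mule0.
have E0 (a : measurableTypeR R) : (0 <= (expR (- `|a| * h ^+ 2))%:E)%E.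
  by rewrite lee_fin expR_ge0.
rewrite (@ge0_negligible_integral _ _ _ P setT (~` D) _ (measurableC mD)
  measurableT (mE h) (fun a _ => E0 a) PDC).
rewrite setTD setCK.
have cV0 : 0 <= c^-1 by rewrite invr_ge0.
rewrite (@eq_measure_integral _ _ _ D (mscale (NngNum cV0) F)); last first.
  by move=> A mA AD; apply: (etrans (PE A)); rewrite (setIidl AD).
rewrite (ge0_integral_mscale _ mD _ (measurable_funTS (mE h)) (fun a _ => E0 a)).
by rewrite /= muleA -EFinM mulfV// mul1e.
Qed.

Section gaussian_cos.
Context {R : realType} {n : nat} {d : measure_display} {T : measurableType d}.
Variables (P : probability T R) (v : T -> 'cV[R]_n).
Hypothesis mv : measurable_mx v.
Hypothesis vE : forall (S : 'M[R]_n) (h : 'cV[R]_n) (r c : R),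
  real_posdef S -> `|r| <= 1 ->
  (\int[P]_t (fourier_integrand S h r c (v t))%:E =
   ((Num.sqrt (\det S))^-1 *
    (1 + r * expR (- (quadmx (invmx S) h / 2)) * cos c))%:E)%E.

(** For positive definite S, up to a constant factor, the density of the centred normal law with
    precision matrix S relative to the standard normal law. *)
Definition gauss_density (S : 'M[R]_n) (z : 'cV[R]_n) : R :=
  expR (quadmx 1%:M z / 2) * expR (- (quadmx S z / 2)).

Lemma integrable_fourier S h r c : real_posdef S -> `|r| <= 1 ->
  P.-integrable setT (fun t => (fourier_integrand S h r c (v t))%:E).
Proof.
move=> Spd r1; apply/integrableP; split.
  by apply/measurable_EFinP; exact: measurable_fourier_integrand.
under eq_integral do rewrite gee0_abs ?lee_fin ?fourier_integrand_ge0//.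
by rewrite vE// ltry.
Qed.

Lemma gauss_densityE S h z : gauss_density S z = fourier_integrand S h 0 0 z.
Proof. by rewrite /fourier_integrand mul0r addr0 mul1r. Qed.

Lemma integrable_gauss_density S : real_posdef S ->
  P.-integrable setT (fun t => (gauss_density S (v t))%:E).
Proof.
move=> Spd; under eq_fun do rewrite (gauss_densityE _ 0).
by apply: integrable_fourier; rewrite ?normr0.
Qed.

Lemma integral_gauss_cos S h : real_posdef S ->
  (\int[P]_t (cos ((h^T *m v t) 0 0) * gauss_density S (v t))%:E =
   ((Num.sqrt (\det S))^-1 * expR (- (quadmx (invmx S) h / 2)))%:E)%E.
Proof.
move=> Spd.
have n0 : `|0 : R| <= 1 by rewrite normr0.
have n1 : `|1 : R| <= 1 by rewrite normr1.
have i0 := integrable_fourier h 0 Spd n0.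
have i1 := integrable_fourier h 0 Spd n1.
(* Subtracting the case r = 0 from r = 1 removes the summand 1 that kept the integrand
   nonnegative. *)
transitivity (\int[P]_t ((fourier_integrand S h 1 0 (v t))%:E -
    (fourier_integrand S h 0 0 (v t))%:E))%E.
  apply: eq_integral => t _; rewrite -EFinB; congr EFin.
  by rewrite /fourier_integrand addr0 /gauss_density; ring.
rewrite integralB// !vE// -EFinB; congr EFin.
by rewrite cos0; ring.
Qed.

End gaussian_cos.

(** A quadratic form does not distinguish B from B^T. The fields produce the form of A_j^T G A_k
    itself; the Gaussian integral needs a symmetric matrix, and this identity connects the two. *)
Lemma quadmx_sympart (R : realType) n (M B : 'M[R]_n) (v : 'cV[R]_n) :
  quadmx (M - sympart B) v = quadmx M v - quadmx B v.
Proof.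
have BT : quadmx B^T v = quadmx B v.
  by rewrite /quadmx -[in RHS](trmxK (v^T *m B *m v)) [RHS]mxE !trmx_mul trmxK mulmxA.
have lin (X Y : 'M[R]_n) (a : R) : quadmx (X + a *: Y) v = quadmx X v + a * quadmx Y v.
  by rewrite /quadmx mulmxDr mulmxDl -scalemxAr -scalemxAl mxE [X in _ + X]mxE.
rewrite /sympart scalerDr opprD -!scaleNr addrA !lin BT; lra.
Qed.

Lemma quadmx_mul3 (R : realType) l n (A B : 'M[R]_(l, n)) (G : 'M[R]_l) (v : 'cV[R]_n) :
  quadmx (A^T *m G *m B) v = \sum_p \sum_q (A *m v) p 0 * (B *m v) q 0 * G p q.
Proof.
have -> : quadmx (A^T *m G *m B) v = ((A *m v)^T *m G *m (B *m v)) 0 0.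
  by rewrite /quadmx trmx_mul !mulmxA.
rewrite -mulmxA mxE; apply: eq_bigr => p _.
rewrite !mxE mulr_sumr; apply: eq_bigr => q _.
by rewrite -mulrA; congr (_ * _); rewrite mulrC.
Qed.

Section spectral_kernel.
Context {R : realType} {l m d : nat}.
Variables (A : 'I_m -> 'M[R]_(l, d)) (G : 'cV[R]_d -> 'cV[R]_d -> 'M[R]_l)
  (M : 'M[R]_d) (c : R).
Hypothesis hG : cross_covariance (fun x y => complexmx (G x y)).
Hypothesis c0 : 0 <= c.
Context {dT : measure_display} {T : measurableType dT} (v : T -> 'cV[R]_d).
Hypothesis mv : measurable_mx v.

(** The kernel before averaging: [z.1] is the mixing parameter, [v z.2] the Gaussian frequency, and
    [c] the mass of the mixing measure. *)
Definition spectral_kernel (i k : 'cV[R]_d * 'I_m) (z : measurableTypeR R * T) : R :=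
  c * (cos (Num.sqrt (2 * `|z.1|) * ((i.1 - k.1)^T *m v z.2) 0 0) *
    gauss_density (M - sympart ((A i.2)^T *m G i.1 k.1 *m A k.2)) (v z.2)).

Let mv2 : measurable_mx (fun z : measurableTypeR R * T => v z.2).
Proof. by move=> i j; exact: (measurableT_comp (mv i j) measurable_snd). Qed.

Let mfreq : measurable_fun setT
  (fun z : measurableTypeR R * T => Num.sqrt (2 * `|z.1|)).
Proof.
apply: (@measurableT_comp _ _ _ _ _ _ (@Num.sqrt R)).
  by apply: continuous_measurable_fun; exact: sqrt_continuous.
apply: measurable_funM; first exact: measurable_cst.
by apply: (measurableT_comp (@normr_measurable R setT)); exact: measurable_fst.
Qed.

Lemma gram_spectral_kernel : gram_kernel spectral_kernel.
Proof.
pose g (i : 'cV[R]_d * 'I_m) (z : measurableTypeR R * T) :=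
  Num.sqrt (2 * `|z.1|) * (i.1^T *m v z.2) 0 0.
(* Quarters, because the rank one kernel squares [w] and [gauss_density] has halves. *)
pose w (z : measurableTypeR R * T) :=
  expR (quadmx 1%:M (v z.2) / 4) * expR (- (quadmx M (v z.2) / 4)).
pose u (i : 'cV[R]_d * 'I_m) (p : 'I_l) (z : measurableTypeR R * T) :=
  (A i.2 *m v z.2) p 0.
have mg i : measurable_fun setT (g i).
  by apply: measurable_funM => //; exact: measurable_dotmx.
have mw : measurable_fun setT w.
  apply: measurable_funM; apply: measurable_expR_comp.
    by apply: measurable_funM => //; exact: measurable_quadmx.
  by apply: measurable_funN; apply: measurable_funM => //; exact: measurable_quadmx.
have mu i p : measurable_fun setT (u i p).
  have mA : measurable_mx (fun _ : measurableTypeR R * T => A i.2).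
    exact: measurable_mx_cst.
  exact: (measurable_mx_mul mA mv2 p 0).
have gG := @gram_lincomb _ _ _ _ _ _ l
  (fun (i : 'cV[R]_d * 'I_m) p => (i.1, p)) u
  (@cross_covariance_gram _ _ (measurableTypeR R * T)%type _ _ _ hG) mu.
have half : 0 <= 2^-1 :> R by rewrite invr_ge0.
apply: (eq_gram_kernel _ (gramZ c0 (gramM (gramM (gram_rank1 (fun _ => mw))
  (gram_cos mg)) (gram_expR (gramZ half gG))))) => i k z /=.
congr (c * _); rewrite mulrAC mulrC; congr (_ * _).
  rewrite /g -mulrBr linearB /= mulmxBl; congr (cos (_ * _)).
  by rewrite [RHS]mxE; congr (_ + _); rewrite [RHS]mxE.
rewrite /gauss_density quadmx_sympart quadmx_mul3 /w /u /=.
rewrite -!expRD; congr expR; lra.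
Qed.

Variables (P : probability T R) (Pa : probability (measurableTypeR R) R) (phi : R -> R).
Hypothesis vE : forall (S : 'M[R]_d) (h : 'cV[R]_d) (r c : R),
  real_posdef S -> `|r| <= 1 ->
  (\int[P]_t (fourier_integrand S h r c (v t))%:E =
   ((Num.sqrt (\det S))^-1 *
    (1 + r * expR (- (quadmx (invmx S) h / 2)) * cos c))%:E)%E.
Hypothesis phiE : forall h, 0 <= h ->
  (c%:E * \int[Pa]_(a in [set: measurableTypeR R]) (expR (- `|a| * h ^+ 2))%:E =
   (phi h)%:E)%E.

Lemma integral_spectral_kernel (i k : 'cV[R]_d * 'I_m) :
  let S := M - sympart ((A i.2)^T *m G i.1 k.1 *m A k.2) in
  real_posdef S ->
  (\int[Pa \x P]_z (spectral_kernel i k z)%:E =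
   (phi (Num.sqrt (quadmx (invmx S) (i.1 - k.1))) / Num.sqrt (\det S))%:E)%E.
Proof.
move=> S Spd; set q := quadmx _ _.
have q0 : 0 <= q by exact: quadmx_inv_ge0.
have mK : measurable_fun setT (spectral_kernel i k).
  apply: measurable_funM => //; apply: measurable_funM.
    apply: measurable_cos_comp; apply: measurable_funM => //.
    exact: measurable_dotmx.
  apply: measurable_funM; apply: measurable_expR_comp.
    by apply: measurable_funM => //; exact: measurable_quadmx.
  by apply: measurable_funN; apply: measurable_funM => //; exact: measurable_quadmx.
have iw := integrable_gauss_density mv vE Spd.
(* The cosine changes sign, so Fubini needs a majorant: dropping the cosine leaves an integrable
   product independent of the mixing parameter. *)
rewrite -integral12_prod_meas1; last first.
  apply: (@le_integrable _ _ _ _ setT measurableT _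
    (fun z : measurableTypeR R * T => (cst c z.1 * gauss_density S (v z.2))%:E)).
  - exact/measurable_EFinP.
  - move=> z _ /=; rewrite lee_fin /spectral_kernel -/S !normrM.
    rewrite (ger0_norm c0) ler_wpM2l// -[leRHS]mul1r ler_wpM2r//.
    by rewrite ler_norml cos_geN1 cos_le1.
  - apply: (@integrable_prod_mul _ _ _ _ _ Pa P (cst c)
      (fun t => gauss_density S (v t))) => //.
    exact: finite_measure_integrable_cst.
have mexp : measurable_fun setT (fun a : measurableTypeR R =>
    (expR (- `|a| * Num.sqrt q ^+ 2))%:E).
  apply/measurable_EFinP/measurable_expR_comp/measurable_funM => //.
  by apply: measurable_funN; exact: (@normr_measurable R setT).
transitivity (\int[Pa]_a ((((Num.sqrt (\det S))^-1 * c)%:E *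
    (expR (- `|a| * Num.sqrt q ^+ 2))%:E)))%E.
  apply: eq_integral => a _; rewrite /fubini_F /spectral_kernel /= -/S.
  (* The scaling multiplies the inverse form by 2 |a|, so exp (- quadmx (invmx S) h / 2) becomes exp
     (- |a| q), the integrand that represents [phi] at the square root of [q]. *)
  set h := Num.sqrt (2 * `|a|) *: (i.1 - k.1).
  have hE t : Num.sqrt (2 * `|a|) * ((i.1 - k.1)^T *m v t) 0 0 = (h^T *m v t) 0 0.
    rewrite /h (_ : (_ *: _)^T = Num.sqrt (2 * `|a|) *: (i.1 - k.1)^T).
      by rewrite -scalemxAl [RHS]mxE.
    by apply/matrixP => p r; rewrite !mxE.
  transitivity (c%:E * \int[P]_t (cos ((h^T *m v t) 0 0) * gauss_density S (v t))%:E)%E.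
    rewrite -integralZl//.
      by apply: eq_integral => t _; rewrite -EFinM hE.
    apply: (@le_integrable _ _ _ _ setT measurableT _ _ _ _ iw) => //.
      apply/measurable_EFinP; apply: measurable_funM.
        by apply: measurable_cos_comp; exact: measurable_dotmx.
      by apply/measurable_EFinP; exact: (measurable_int _ iw).
    move=> t _ /=; rewrite lee_fin normrM -[leRHS]mul1r ler_wpM2r//.
    by rewrite ler_norml cos_geN1 cos_le1.
  rewrite (integral_gauss_cos mv vE _ Spd) -!EFinM; congr EFin.
  rewrite mulrA (mulrC c); congr (_ * expR _).
  rewrite sqr_sqrtr// mulNr; congr (- _).
  have -> : quadmx (invmx S) h = 2 * `|a| * q.
    rewrite /q /quadmx /h.
    rewrite (_ : (_ *: _)^T = Num.sqrt (2 * `|a|) *: (i.1 - k.1)^T); last first.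
      by apply/matrixP => p r; rewrite !mxE.
    by rewrite -scalemxAr -!scalemxAl scalerA mxE -expr2 sqr_sqrtr// mulr_ge0.
  by field.
rewrite ge0_integralZl//.
- by rewrite EFinM -muleA phiE ?sqrtr_ge0// -EFinM mulrC.
- by rewrite lee_fin mulr_ge0// invr_ge0 sqrtr_ge0.
Qed.

End spectral_kernel.

Theorem theorem17 (R : realType) (l m d : nat)
  (l_gt0 : (0 < l)%N) (m_gt0 : (0 < m)%N) (d_gt0 : (0 < d)%N)
  (A : 'I_m -> 'M[R]_(l, d)) (phi : R -> R)
  (hphi : normal_scale_mixture phi)
  (G : 'cV[R]_d -> 'cV[R]_d -> 'M[R]_l)
  (hG : cross_covariance (fun x y => complexmx (G x y)))
  (M : 'M[R]_d) (hM : posdefmx (complexmx M))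
  (hMG : forall (x y : 'cV[R]_d) (j k : 'I_m),
    strict_posdefmx (complexmx (M - sympart ((A j)^T *m G x y *m A k)))) :
  cross_covariance (fun x y : 'cV[R]_d => complexmx (\matrix_(j < m, k < m)
    (phi (Num.sqrt (((x - y)^T
                     *m invmx (M - sympart ((A j)^T *m G x y *m A k))
                     *m (x - y)) 0 0))
     / Num.sqrt (\det (M - sympart ((A j)^T *m G x y *m A k)))))).
Proof.
have [Pa [c [c0 phiE]]] := normal_scale_mixture_prob hphi.
have [dT [T [P [v [mv vE]]]]] := @gaussian_vector R d.
apply: (@gram_cross_covariance _ _ _ _ _ (Pa \x P)%E _ _
  (gram_spectral_kernel A M hG c0 mv)) => x y j k.
rewrite (integral_spectral_kernel c0 mv vE phiE) /=; last exact: real_posdef_complexmx.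
by rewrite mxE.
Qed.
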